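(* Let $V=\mathbb{C}^m$, let $\kappa$ be a nonzero complex number and let $u=\mathrm{diag}(u_1,\dots,u_m)$ have pairwise distinct diagonal entries such that the diagonal entries of $\frac1\kappa u$ are purely imaginary. Let $R=e^{\frac{\pi i}{\kappa}[\Omega]}S_+\in\mathrm{End}(V)^{\otimes2}$ be the Stokes multiplier of the equation $$\kappa\frac{dY}{dz}=\Big(u\otimes 1+\frac{\Omega}{z}\Big)\cdot Y .$$ Then $R$ satisfies the Yang–Baxter equation $$R^{12}R^{13}R^{23}=R^{23}R^{13}R^{12}\in\mathrm{End}(V)^{\otimes3}.$$
   Context: Notation. $E_{ab}$ is the elementary $m\times m$ matrix with a single $1$ in position $(a,b)$; $\Omega=\sum_{1\le a,b\le m}E_{ab}\otimes E_{ba}$ and $[\Omega]=\sum_{a}E_{aa}\otimes E_{aa}$ in $\mathrm{End}(V)^{\otimes2}$; $u^{(1)}=u\otimes1$. If $R=\sum X_a\otimes Y_a$ then $R^{12}=\sum X_a\otimes Y_a\otimes1$, $R^{13}=\sum X_a\otimes1\otimes Y_a$, $R^{23}=\sum1\otimes X_a\otimes Y_a$. Stokes multiplier $R$. The equation $\kappa\frac{dY}{dz}=(u^{(1)}+\frac{\Omega}{z})Y$ has a unique formal fundamental solution at $z=\infty$ of the form $\hat Y=\hat H(z)\,e^{\frac z\kappa u^{(1)}}z^{\frac1\kappa[\Omega]}$ with $\hat H=1+H_1z^{-1}+H_2z^{-2}+\cdots$, $H_l\in\mathrm{End}(V)^{\otimes2}$. It resums to a canonical holomorphic solution $Y_+$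 in the right half plane $\mathbb{H}_+$ (resp. $Y_-$ in the left half plane $\mathbb{H}_-$): $Y_\pm=H_\pm\,e^{\frac z\kappa u^{(1)}}z^{\frac1\kappa[\Omega]}$ is the unique solution of this form such that $H_\pm$ is holomorphic on $\mathbb{H}_\pm$, can be analytically continued to the supersector obtained by enlarging $\mathbb{H}_\pm$ by an angle $\frac\pi2$ on each side, and is asymptotic to $\hat H$ as $z\to\infty$ within that supersector. The Stokes matrices $S_\pm\in\mathrm{End}(V)^{\otimes 2}$ are determined by $$Y_-=Y_+\cdot S_+,\qquad Y_+=Y_-\cdot e^{\frac{2\pi i}{\kappa}[\Omega]}\cdot S_-,$$ where the first (resp. second) identity is understood to hold in $\mathbb{H}_-$ (resp. $\mathbb{H}_+$) after $Y_+$ (resp. $Y_-$) has been analytically continued counterclockwise. The factor $e^{\frac{2\pi i}{\kappa}[\Omega]}$ is the formal monodromy, and the Stokes multiplier is $R=e^{\frac{\pi i}{\kappa}[\Omega]}S_+$. *)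

(* Defs.v *)
From HB Require Import structures.
From mathcomp Require Import all_boot all_order all_algebra complex mxtens ring.
From mathcomp Require Import all_classical all_reals all_analysis.

Set Implicit Arguments.
Unset Strict Implicit.
Unset Printing Implicit Defensive.

Import Order.TTheory GRing.Theory Num.Theory.
Import numFieldNormedType.Exports.

Local Open Scope classical_set_scope.
Local Open Scope ring_scope.
Local Open Scope complex_scope.

Section Tensors.
Variables (F : comNzRingType) (m : nat).
Implicit Types (A : 'M[F]_(m * m)) (X Y : 'M[F]_m).

Definition Omega : 'M[F]_(m * m) :=
  \sum_(a < m) \sum_(b < m) delta_mx a b *t delta_mx b a.

Definition diagOmega : 'M[F]_(m * m) :=
  \sum_(a < m) delta_mx a a *t delta_mx a a.

(* The coefficient of E_ab (x) E_cd in A. *)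
Definition tens_coef A (a b c d : 'I_m) : F :=
  A (mxtens_index (a, c)) (mxtens_index (b, d)).

(* End(V)^(x)3 is 'M_(m * m * m), with the factors associated to the left.    *)
(* The legs are defined by linear extension from the basis E_ab (x) E_cd; see *)
(* tens_coefE and the leg*_tens lemmas.                                       *)
Definition leg12 A : 'M[F]_(m * m * m) :=
  \sum_a \sum_b \sum_c \sum_d
    tens_coef A a b c d *: (delta_mx a b *t delta_mx c d *t 1%:M).

Definition leg13 A : 'M[F]_(m * m * m) :=
  \sum_a \sum_b \sum_c \sum_d
    tens_coef A a b c d *: (delta_mx a b *t 1%:M *t delta_mx c d).

Definition leg23 A : 'M[F]_(m * m * m) :=
  \sum_a \sum_b \sum_c \sum_d
    tens_coef A a b c d *: (1%:M *t delta_mx a b *t delta_mx c d).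

Let sum_delta4 (f : 'I_m -> 'I_m -> 'I_m -> 'I_m -> F) i j k l :
  \sum_a \sum_b \sum_c \sum_d
    f a b c d * (delta_mx a b i j * delta_mx c d k l) = f i j k l.
Proof.
rewrite (bigD1 i) //= (bigD1 j) //= (bigD1 k) //= (bigD1 l) //=.
rewrite !mxE !eqxx !mulr1 big1 => [|d ld]; last first.
  by rewrite !mxE [l == d]eq_sym (negPf ld) andbF !mulr0.
rewrite big1 => [|c kc]; last first.
  by rewrite big1 // => d _; rewrite !mxE [k == c]eq_sym (negPf kc) !mulr0.
rewrite big1 => [|b jb]; last first.
  rewrite big1 // => c _; rewrite big1 // => d _.
  by rewrite !mxE [j == b]eq_sym (negPf jb) andbF mul0r mulr0.
rewrite big1 ?addr0 // => a ia.
rewrite big1 // => b _; rewrite big1 // => c _; rewrite big1 // => d _.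
by rewrite !mxE [i == a]eq_sym (negPf ia) mul0r mulr0.
Qed.

Let sumE4 n (f : 'I_m -> 'I_m -> 'I_m -> 'I_m -> 'M[F]_n) i j :
  (\sum_a \sum_b \sum_c \sum_d f a b c d) i j =
  \sum_a \sum_b \sum_c \sum_d f a b c d i j.
Proof.
rewrite summxE; apply: eq_bigr => a _; rewrite summxE; apply: eq_bigr => b _.
by rewrite summxE; apply: eq_bigr => c _; rewrite summxE.
Qed.

Let eq_sum4 (f g : 'I_m -> 'I_m -> 'I_m -> 'I_m -> F) :
  (forall a b c d, f a b c d = g a b c d) ->
  \sum_a \sum_b \sum_c \sum_d f a b c d = \sum_a \sum_b \sum_c \sum_d g a b c d.
Proof. by move=> fg; do 4![apply: eq_bigr => ? _]. Qed.

Lemma tens_coefE A :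
  A = \sum_a \sum_b \sum_c \sum_d
        tens_coef A a b c d *: (delta_mx a b *t delta_mx c d).
Proof.
apply/matrixP => i j.
case: (mxtens_indexP i) => i1 i2; case: (mxtens_indexP j) => j1 j2.
rewrite sumE4 -[LHS](sum_delta4 (tens_coef A)).
by apply: eq_sum4 => a b c d; rewrite [RHS]mxE tensmxE.
Qed.

Lemma leg12_tens X Y : leg12 (X *t Y) = X *t Y *t 1%:M.
Proof.
apply/matrixP => i j.
case: (mxtens_indexP i) => i' i3; case: (mxtens_indexP j) => j' j3.
case: (mxtens_indexP i') => i1 i2; case: (mxtens_indexP j') => j1 j2.
rewrite sumE4.
rewrite (eq_sum4 (g := fun a b c d => (X a b * Y c d * (1%:M : 'M[F]_m) i3 j3) *
  (delta_mx a b i1 j1 * delta_mx c d i2 j2))) => [|a b c d]; last first.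
  by rewrite [LHS]mxE /tens_coef !tensmxE; ring.
by rewrite (sum_delta4 (fun a b c d => X a b * Y c d * 1%:M i3 j3)) !tensmxE; ring.
Qed.

Lemma leg13_tens X Y : leg13 (X *t Y) = X *t 1%:M *t Y.
Proof.
apply/matrixP => i j.
case: (mxtens_indexP i) => i' i3; case: (mxtens_indexP j) => j' j3.
case: (mxtens_indexP i') => i1 i2; case: (mxtens_indexP j') => j1 j2.
rewrite sumE4.
rewrite (eq_sum4 (g := fun a b c d => (X a b * Y c d * (1%:M : 'M[F]_m) i2 j2) *
  (delta_mx a b i1 j1 * delta_mx c d i3 j3))) => [|a b c d]; last first.
  by rewrite [LHS]mxE /tens_coef !tensmxE; ring.
by rewrite (sum_delta4 (fun a b c d => X a b * Y c d * 1%:M i2 j2)) !tensmxE; ring.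
Qed.

Lemma leg23_tens X Y : leg23 (X *t Y) = 1%:M *t X *t Y.
Proof.
apply/matrixP => i j.
case: (mxtens_indexP i) => i' i3; case: (mxtens_indexP j) => j' j3.
case: (mxtens_indexP i') => i1 i2; case: (mxtens_indexP j') => j1 j2.
rewrite sumE4.
rewrite (eq_sum4 (g := fun a b c d => (X a b * Y c d * (1%:M : 'M[F]_m) i1 j1) *
  (delta_mx a b i2 j2 * delta_mx c d i3 j3))) => [|a b c d]; last first.
  by rewrite [LHS]mxE /tens_coef !tensmxE; ring.
by rewrite (sum_delta4 (fun a b c d => X a b * Y c d * 1%:M i1 j1)) !tensmxE; ring.
Qed.

End Tensors.

Section Stokes.
Variable RR : realType.
Local Notation C := RR[i].

Definition cexp (z : C) : C :=
  (expR (complex.Re z) * cos (complex.Im z))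
    +i* (expR (complex.Re z) * sin (complex.Im z)).

Definition cabs (z : C) : RR :=
  Num.sqrt (complex.Re z ^+ 2 + complex.Im z ^+ 2).

(* The principal argument, in ]-pi, pi]. *)
Definition carg (z : C) : RR :=
  if 0 <= complex.Im z then acos (complex.Re z / cabs z)
  else - acos (complex.Re z / cabs z).

Definition clog (z : C) : C := ln (cabs z) +i* carg z.

(* In what follows a boolean b selects a side: false stands for the right     *)
(* half plane H_+ and true for the left half plane H_- = - H_+.               *)

Definition half_plane (b : bool) : set C :=
  [set z | 0 < complex.Re ((-1) ^+ b * z)].

(* The open sector of half-opening theta around the bisector of H_+ / H_-. *)
Definition sector (b : bool) (theta : RR) : set C :=
  [set z | z != 0 /\ `|carg ((-1) ^+ b * z)| < theta].

Definition supersector (b : bool) : set C := sector b (pi / 2 + pi / 2).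

(* The branch of log z on each side: log is real on the positive real axis    *)
(* and cut along the nonnegative imaginary axis, so its imaginary part is in  *)
(* ]-pi/2, pi/2[ on H_+ and in ]-3pi/2, -pi/2[ on H_-.  Each of the two is    *)
(* continued to the corresponding supersector.                                *)
Definition blog (b : bool) (z : C) : C :=
  clog ((-1) ^+ b * z) - (0 +i* (pi *+ b)).

(* The exponential of a diagonal matrix. *)
Definition expdiag n (A : 'M[C]_n) : 'M[C]_n :=
  \matrix_(i, j) (cexp (A i i) *+ (i == j)).

Definition holomorphic_on n (D : set C) (F : C -> 'M[C]_n) : Prop :=
  forall z, D z -> forall i j,
    derivable (fun t : C^o => F t i j : C^o) (z : C^o) 1.

Definition is_derive_mx n (F : C -> 'M[C]_n) (z : C) (dF : 'M[C]_n) : Prop :=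
  forall i j, is_derive (z : C^o) 1 (fun t : C^o => F t i j : C^o) (dF i j).

Section System.
Variables (m : nat) (kappa : C) (u : 'rV[C]_m).

Local Notation M := 'M[C]_(m * m).
Local Notation Omega := (Omega C m).
Local Notation diagOmega := (diagOmega C m).

Definition u1 : M := diag_mx u *t 1%:M.

Definition is_solution (D : set C) (Y : C -> M) : Prop :=
  forall z, D z -> exists2 dY, is_derive_mx Y z dY &
    kappa *: dY = (u1 + z^-1 *: Omega) *m Y z.

(* [Hf l] is the coefficient of z^-l of the formal series H^.  Substituting   *)
(* H^ e^(z u1 / kappa) z^([Omega] / kappa) in the equation (u1 and [Omega]    *)
(* commute) gives kappa H^' + H^ (u1 + [Omega]/z) = (u1 + Omega/z) H^; the    *)
(* second clause is the coefficient of z^-(l+1), and the coefficient of z^0   *)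
(* is the trivial identity 1 u1 = u1 1.                                       *)
Definition formal_solution (Hf : nat -> M) : Prop :=
  Hf 0%N = 1%:M /\
  forall l, - ((kappa *+ l) *: Hf l) + Hf l.+1 *m u1 + Hf l *m diagOmega
            = u1 *m Hf l.+1 + Omega *m Hf l.

(* H ~ sum_l Hf l z^-l at infinity in the supersector, i.e. uniformly on      *)
(* every proper subsector with the same bisector.                             *)
Definition asymptotic_to (b : bool) (H : C -> M) (Hf : nat -> M) : Prop :=
  forall (theta : RR) (N : nat), theta < pi / 2 + pi / 2 ->
  exists K r : RR, forall z, sector b theta z -> r <= cabs z ->
    forall i j,
      cabs ((H z - \sum_(l < N) z ^- l *: Hf l) i j) <= K * cabs z ^- N.

Definition with_exponents (b : bool) (H : C -> M) (z : C) : M :=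
  H z *m expdiag ((z / kappa) *: u1) *m expdiag ((blog b z / kappa) *: diagOmega).

(* [H] is H_+ (b = false) or H_- (b = true), together with its continuation   *)
(* to the supersector, and [with_exponents b H] is Y_+ or Y_-.                *)
Definition canonical_factor (b : bool) (Hf : nat -> M) (H : C -> M) : Prop :=
  [/\ holomorphic_on (supersector b) H,
      is_solution (half_plane b) (with_exponents b H) &
      asymptotic_to b H Hf].

(* [Yc] is the analytic continuation of [Y] from its half plane to the        *)
(* opposite one in the counterclockwise direction: it agrees with [Y] on the  *)
(* part of the supersector reached first, namely the second quadrant from H_+ *)
(* and the fourth quadrant from H_-.                                          *)
Definition ccw_continuation (b : bool) (Y Yc : C -> M) : Prop :=
  holomorphic_on (half_plane (~~ b)) Yc /\
  forall z, half_plane (~~ b) z -> 0 < complex.Im ((-1) ^+ b * z) -> Yc z = Y z.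

Definition stokes_matrices (Sp Sm : M) : Prop :=
  exists (Hf : nat -> M) (Hp Hm : C -> M),
  let Yp := with_exponents false Hp in
  let Ym := with_exponents true Hm in
  [/\ formal_solution Hf,
      canonical_factor false Hf Hp,
      canonical_factor true Hf Hm,
      exists2 Yc, ccw_continuation false Yp Yc &
        forall z, half_plane true z -> Ym z = Yc z *m Sp &
      exists2 Yc, ccw_continuation true Ym Yc &
        forall z, half_plane false z ->
          Yp z = Yc z *m expdiag (((0 +i* (pi *+ 2)) / kappa) *: diagOmega) *m Sm].

Definition stokes_multiplier (R : M) : Prop :=
  exists Sp Sm, stokes_matrices Sp Sm /\
    R = expdiag (((0 +i* pi) / kappa) *: diagOmega) *m Sp.

End System.
End Stokes.

(* Main.v *)
(** The system preserves each block spanned by e_a (x) e_b and e_b (x) e_a, so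
    that R is the Hecke-type R-matrix: with p = e^(-i pi / kappa) it multiplies
    e_a (x) e_a by p and acts on a two-dimensional block as a unipotent matrix
    whose single off-diagonal entry s sits where e^((u_a - u_b) z / kappa)
    decays in the upper half plane.  For s = p - p^-1 the Yang-Baxter equation
    is a finite verification.

    To find s, write P for the flip of the two factors.  Uniqueness of the
    canonical solutions gives, on each block, Y_-(z) = e^((u_a + u_b) z / kappa)
    P Y_+(-z) P for Re z < 0, so Y_+(-z) = e^(-(u_a + u_b) z / kappa) P Y_+(z) P
    S_+^-1 for z in the fourth quadrant.  Hence P Y_+(-z) Y_+(z)^-1 has trace
    -s e^(-(u_a + u_b) z / kappa).  As z tends to 0 the equation on the
    half-circle from z to -z becomes Y' = (i pi / kappa) P Y in the angular
    variable, so the trace tends to tr (P e^(i pi P / kappa)) = p^-1 - p.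

    When 1 / kappa is a nonzero integer the formal solution is not unique and
    need not preserve the blocks; then Y_+ and Y_- differ from their block parts
    by the same constant factor, and the block part of S_+ is the identity. *)
Require Import Defs.
From mathcomp Require Import all_boot all_order all_algebra complex mxtens ring lra.
From mathcomp Require Import all_classical all_reals all_analysis.
Import Order.TTheory GRing.Theory Num.Theory.
Import numFieldNormedType.Exports.
Set Implicit Arguments.
Unset Strict Implicit.
Unset Printing Implicit Defensive.
Local Open Scope classical_set_scope.
Local Open Scope ring_scope.
Local Open Scope complex_scope.

(** * Complex numbers and differentiation along real curves *)

(** [stokes_multiplier] is a predicate, so S_+ has to be computed for arbitrary witnesses H^, H_+
    and H_-, and nothing says in advance that they respect the blocks. One mechanism serves all
    comparisons: two solutions on a common half plane differ by a constant right factor, whose (i,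
    j) entry appears along a ray multiplied by e_i / e_j, where e_j is the j-th diagonal
    exponential. As u / kappa is imaginary, this ratio grows or decays exponentially with Im z if
    the exponents of i and j differ, and is a mere power of z if they agree. In the first case
    boundedness along a suitable ray kills the entry; in the second the expansion is needed to all
    orders. Indices of distinct blocks may share an exponent, which is how an integral 1 / kappa
    causes trouble.

    Constants can be detected along sequences n w, so real-variable calculus suffices and holomorphy
    serves as a chain rule along curves. The equation for Y_+ is given in H_+ only, but the
    half-circle also crosses the upper half plane; in the second quadrant Y_+ = Y_- S_+^-1 provides
    it, and a limit of derivatives settles the imaginary axis. *)

Section ComplexBasics.
Variable RR : realType.
Local Notation C := RR[i].
Implicit Types x y z : C.

Lemma cReD x y : complex.Re (x + y) = complex.Re x + complex.Re y.
Proof. by case: x => a b; case: y => c d. Qed.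
Lemma cImD x y : complex.Im (x + y) = complex.Im x + complex.Im y.
Proof. by case: x => a b; case: y => c d. Qed.
Lemma cReN x : complex.Re (- x) = - complex.Re x.
Proof. by case: x. Qed.
Lemma cImN x : complex.Im (- x) = - complex.Im x.
Proof. by case: x. Qed.
Lemma cReM x y :
  complex.Re (x * y) = complex.Re x * complex.Re y - complex.Im x * complex.Im y.
Proof. by case: x => a b; case: y => c d. Qed.
Lemma cImM x y :
  complex.Im (x * y) = complex.Re x * complex.Im y + complex.Im x * complex.Re y.
Proof. by case: x => a b; case: y => c d. Qed.
Lemma cReV x : complex.Re x^-1 =
  complex.Re x / (complex.Re x ^+ 2 + complex.Im x ^+ 2).
Proof. by case: x. Qed.
Lemma cImV x : complex.Im x^-1 =
  - (complex.Im x / (complex.Re x ^+ 2 + complex.Im x ^+ 2)).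
Proof. by case: x. Qed.
Lemma complex_ext x y :
  complex.Re x = complex.Re y -> complex.Im x = complex.Im y -> x = y.
Proof. by case: x => a b; case: y => c d /= -> ->. Qed.

Definition ReImE := (cReD, cImD, cReN, cImN, cReM, cImM).

Lemma cabsE x : cabs x = Normc.normc x.
Proof. by case: x. Qed.
Lemma cabs_ge0 x : 0 <= cabs x.
Proof. exact: sqrtr_ge0. Qed.
Lemma cabs0 : cabs (0 : C) = 0.
Proof. by rewrite cabsE Normc.normc0. Qed.
Lemma cabs1 : cabs (1 : C) = 1.
Proof. by rewrite cabsE Normc.normc1. Qed.
Lemma cabsM x y : cabs (x * y) = cabs x * cabs y.
Proof. by rewrite !cabsE Normc.normcM. Qed.
Lemma cabsV x : cabs x^-1 = (cabs x)^-1.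
Proof. by rewrite !cabsE Normc.normcV. Qed.
Lemma cabsD x y : cabs (x + y) <= cabs x + cabs y.
Proof. by rewrite !cabsE le_normcD. Qed.
Lemma cabsN x : cabs (- x) = cabs x.
Proof. by rewrite !cabsE normcN. Qed.
Lemma cabs_eq0 x : (cabs x == 0) = (x == 0).
Proof.
apply/eqP/eqP => [|->]; last exact: cabs0.
by rewrite cabsE => /Normc.eq0_normc.
Qed.
Lemma cabs_gt0 x : (0 < cabs x) = (x != 0).
Proof. by rewrite lt_def cabs_ge0 andbT cabs_eq0. Qed.
Lemma cabs_sqr x : cabs x ^+ 2 = complex.Re x ^+ 2 + complex.Im x ^+ 2.
Proof. by rewrite sqr_sqrtr // addr_ge0 ?sqr_ge0. Qed.
Lemma norm_cabs x : `|x| = (cabs x)%:C.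
Proof. exact: normc_def. Qed.
Lemma Re_le_cabs x : `|complex.Re x| <= cabs x.
Proof. by rewrite -sqrtr_sqr ler_wsqrtr // lerDl sqr_ge0. Qed.
Lemma Im_le_cabs x : `|complex.Im x| <= cabs x.
Proof. by rewrite -sqrtr_sqr ler_wsqrtr // lerDr sqr_ge0. Qed.
Lemma cabs_le x : cabs x <= `|complex.Re x| + `|complex.Im x|.
Proof.
rewrite -[leRHS]ger0_norm ?addr_ge0// -sqrtr_sqr ler_wsqrtr // sqrrD.
by rewrite !real_normK ?num_real // lerD2r lerDl mulrn_wge0 // mulr_ge0.
Qed.
Lemma cabs_sum (I : finType) (P : pred I) (f : I -> C) :
  cabs (\sum_(i | P i) f i) <= \sum_(i | P i) cabs (f i).
Proof.
elim/big_ind2: _ => // [|a b c d h1 h2]; first by rewrite cabs0.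
by rewrite (le_trans (cabsD _ _)) // lerD.
Qed.
Lemma cabs_real (r : RR) : cabs r%:C = `|r|.
Proof. by rewrite /cabs /= expr0n addr0 sqrtr_sqr. Qed.
Lemma cabs_nat n : cabs (n%:R : C) = n%:R.
Proof. by rewrite -(rmorph_nat (@real_complex RR)) cabs_real ger0_norm. Qed.
Lemma Re_nat n : complex.Re (n%:R : C) = n%:R.
Proof. by rewrite -(rmorph_nat (@real_complex RR)). Qed.
Lemma Im_nat n : complex.Im (n%:R : C) = 0.
Proof. by rewrite -(rmorph_nat (@real_complex RR)). Qed.
Lemma Re_sum (I : finType) (f : I -> C) :
  complex.Re (\sum_i f i) = \sum_i complex.Re (f i).
Proof. by elim/big_ind2: _ => // a b c d <- <-; rewrite cReD. Qed.
Lemma Im_sum (I : finType) (f : I -> C) :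
  complex.Im (\sum_i f i) = \sum_i complex.Im (f i).
Proof. by elim/big_ind2: _ => // a b c d <- <-; rewrite cImD. Qed.

Lemma cexpD x y : cexp (x + y) = cexp x * cexp y.
Proof.
apply: complex_ext; rewrite /cexp !(ReImE) /= expRD ?cosD ?sinD; ring.
Qed.
Lemma cexp0 : cexp (0 : C) = 1.
Proof. by rewrite /cexp /= expR0 cos0 sin0 mulr1 mulr0. Qed.
Lemma cabs_cexp x : cabs (cexp x) = expR (complex.Re x).
Proof.
rewrite /cabs /cexp /= !exprMn -mulrDr cos2Dsin2 mulr1 sqrtr_sqr.
by rewrite ger0_norm ?expR_ge0.
Qed.
Lemma cexp_neq0 x : cexp x != 0.
Proof. by rewrite -cabs_gt0 cabs_cexp expR_gt0. Qed.
Lemma cexpN x : cexp (- x) = (cexp x)^-1.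
Proof.
apply: (mulfI (cexp_neq0 x)).
by rewrite -cexpD subrr cexp0 mulfV ?cexp_neq0.
Qed.
Lemma cexpMn x n : cexp (x *+ n) = cexp x ^+ n.
Proof. by elim: n => [|n IH]; rewrite ?cexp0 // mulrS exprS cexpD IH. Qed.
Lemma cexp_2pi : cexp (0 +i* (pi *+ 2) : C) = 1.
Proof. by rewrite /cexp /= expR0 !mul1r cos2pi sin2pi. Qed.
Lemma cexp_pi : cexp (0 +i* pi : C) = -1.
Proof.
rewrite /cexp /= expR0 !mul1r cospi sinpi.
by apply: complex_ext; rewrite ReImE //= oppr0.
Qed.

End ComplexBasics.

(** * Derivatives of complex-valued functions of a real variable *)

Section CurveCalculus.
Variable RR : realType.
Local Notation C := RR[i].
Implicit Types (f g : RR -> C) (t : RR) (d e : C).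

Definition is_cderive f t d :=
  is_derive t (1 : RR) (fun x => complex.Re (f x)) (complex.Re d) /\
  is_derive t (1 : RR) (fun x => complex.Im (f x)) (complex.Im d).

Lemma is_cderive_eq f t d e : is_cderive f t d -> d = e -> is_cderive f t e.
Proof. by move=> h <-. Qed.

Lemma is_derive_near (f g : RR -> RR) t (d : RR) :
  (\forall x \near t, f x = g x) -> is_derive t 1 f d -> is_derive t 1 g d.
Proof. exact: near_eq_is_derive. Qed.

Lemma is_cderive_near f g t d :
  (\forall x \near t, f x = g x) -> is_cderive f t d -> is_cderive g t d.
Proof.
move=> fg [h1 h2]; split.
  by apply: is_derive_near h1; near=> x; congr complex.Re; near: x.
by apply: is_derive_near h2; near=> x; congr complex.Im; near: x.
Unshelve. all: by end_near. Qed.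

Lemma is_cderive_ext f g t d : f =1 g -> is_cderive f t d -> is_cderive g t d.
Proof. by move=> fg; have -> : g = f by apply/funext => x; rewrite fg. Qed.

Lemma is_cderive_cst (c : C) t : is_cderive (fun=> c) t 0.
Proof. by split; apply: is_derive_cst. Qed.

Lemma is_cderiveD f g t d e : is_cderive f t d -> is_cderive g t e ->
  is_cderive (fun x => f x + g x) t (d + e).
Proof.
move=> [f1 f2] [g1 g2]; split; rewrite ReImE.
  rewrite (_ : (fun x => _) = (fun x => complex.Re (f x)) + (fun x => complex.Re (g x))).
    exact: is_deriveD.
  by apply/funext => x; rewrite ReImE.
rewrite (_ : (fun x => _) = (fun x => complex.Im (f x)) + (fun x => complex.Im (g x))).
  exact: is_deriveD.
by apply/funext => x; rewrite ReImE.
Qed.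

Lemma is_deriveMf (f g : RR -> RR) t (a b : RR) :
  is_derive t 1 f a -> is_derive t 1 g b ->
  is_derive t 1 (fun x => f x * g x) (a * g t + f t * b).
Proof.
move=> hf hg; have := @is_deriveM RR RR f g t 1 a b hf hg.
rewrite (_ : f * g = fun x => f x * g x) // => h.
by apply: is_derive_eq; rewrite /GRing.scale /=; ring.
Qed.

Lemma is_cderiveM f g t d e : is_cderive f t d -> is_cderive g t e ->
  is_cderive (fun x => f x * g x) t (d * g t + f t * e).
Proof.
move=> [f1 f2] [g1 g2]; split.
  rewrite (_ : (fun x => _) = (fun x => complex.Re (f x) * complex.Re (g x))
    - (fun x => complex.Im (f x) * complex.Im (g x))).
    have h1 := is_deriveMf f1 g1; have h2 := is_deriveMf f2 g2.
    by apply: is_derive_eq; rewrite !ReImE; ring.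
  by apply/funext => x; rewrite ReImE.
rewrite (_ : (fun x => _) = (fun x => complex.Re (f x) * complex.Im (g x))
  + (fun x => complex.Im (f x) * complex.Re (g x))).
  have h1 := is_deriveMf f1 g2; have h2 := is_deriveMf f2 g1.
  by apply: is_derive_eq; rewrite !ReImE; ring.
by apply/funext => x; rewrite ReImE.
Qed.

Lemma is_cderiveZ (c : C) f t d : is_cderive f t d ->
  is_cderive (fun x => c * f x) t (c * d).
Proof.
move=> h; apply: is_cderive_eq (is_cderiveM (is_cderive_cst c t) h) _.
by rewrite mul0r add0r.
Qed.

Lemma is_cderiveN f t d : is_cderive f t d -> is_cderive (fun x => - f x) t (- d).
Proof.
move=> h; rewrite -mulN1r; apply: is_cderive_ext (is_cderiveZ (-1) h) => x.
by rewrite mulN1r.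
Qed.

Lemma is_cderive_real t : is_cderive (fun x => x%:C) t 1.
Proof. by split; [exact: is_derive_id|exact: is_derive_cst]. Qed.

Lemma is_cderive_sum n (f : 'I_n -> RR -> C) t (d : 'I_n -> C) :
  (forall i, is_cderive (f i) t (d i)) ->
  is_cderive (fun x => \sum_i f i x) t (\sum_i d i).
Proof.
move=> h; split; rewrite ?Re_sum ?Im_sum.
  rewrite (_ : (fun x => _) = \sum_(i < n) (fun x => complex.Re (f i x))).
    by apply: is_derive_sum => i; case: (h i).
  by apply/funext => x; rewrite Re_sum fct_sumE.
rewrite (_ : (fun x => _) = \sum_(i < n) (fun x => complex.Im (f i x))).
  by apply: is_derive_sum => i; case: (h i).
by apply/funext => x; rewrite Im_sum fct_sumE.
Qed.

Lemma is_cderive_cexp f t d : is_cderive f t d ->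
  is_cderive (fun x => cexp (f x)) t (d * cexp (f t)).
Proof.
move=> [f1 f2].
have E := is_derive1_comp (is_derive_expR (complex.Re (f t))) f1.
have Cs := is_derive1_comp (is_derive_cos (complex.Im (f t))) f2.
have S := is_derive1_comp (is_derive_sin (complex.Im (f t))) f2.
split; rewrite /cexp /=.
  have := is_deriveMf E Cs => h.
  by apply: is_derive_eq; rewrite !ReImE /=; ring.
have := is_deriveMf E S => h.
by apply: is_derive_eq; rewrite !ReImE /=; ring.
Qed.

Lemma is_cderiveV f t d : f t != 0 -> is_cderive f t d ->
  is_cderive (fun x => (f x)^-1) t (- (d / f t ^+ 2)).
Proof.
move=> f0 [f1 f2].
have n0 : complex.Re (f t) ^+ 2 + complex.Im (f t) ^+ 2 != 0.
  by rewrite -cabs_sqr expf_neq0 // cabs_eq0.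
set N := fun x => complex.Re (f x) * complex.Re (f x) + complex.Im (f x)
  * complex.Im (f x).
have dN : is_derive t 1 N (2 * (complex.Re (f t) * complex.Re d + complex.Im (f t)
  * complex.Im d)).
  have h1 := is_deriveMf f1 f1; have h2 := is_deriveMf f2 f2.
  have := @is_deriveD RR RR RR _ _ _ _ _ _ h1 h2 => h.
  by apply: is_derive_eq; ring.
have Nt : N t != 0 by rewrite /N -!expr2.
have dNV : is_derive t 1 (fun x => (N x)^-1) (- (N t) ^- 2 * (2 * (complex.Re (f t)
  * complex.Re d + complex.Im (f t) * complex.Im d))).
  exact: is_deriveV Nt dN.
have key : d / f t ^+ 2 = d * ((complex.Re (f t) -i* complex.Im (f t)) / (N t)%:C) ^+ 2.
  congr (d * _); rewrite -exprVn; congr (_ ^+ 2).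
  apply: complex_ext; rewrite ?cReV ?cImV !ReImE cReV cImV /N /=; field.
    by rewrite -!expr2 n0.
  by rewrite -!expr2 n0.
rewrite key.
split.
  rewrite (_ : (fun x => _) = (fun x => complex.Re (f x) * (N x)^-1)).
    have := is_deriveMf f1 dNV => h.
    apply: is_derive_eq; rewrite expr2 !ReImE ?cReV ?cImV /= /N; field.
    by rewrite -!expr2 n0.
  by apply/funext => x; rewrite cReV /N !expr2.
rewrite (_ : (fun x => _) = (fun x => (- complex.Im (f x)) * (N x)^-1)).
  have f2' : is_derive t 1 (fun x => - complex.Im (f x)) (- complex.Im d).
    exact: is_deriveN.
  have := is_deriveMf f2' dNV => h.
  apply: is_derive_eq; rewrite expr2 !ReImE ?cReV ?cImV /= /N; field.
  by rewrite -!expr2 n0.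
by apply/funext => x; rewrite cImV /N !expr2 mulNr.
Qed.

End CurveCalculus.

(** * Complex differentiability *)

Section Bridge.
Variable RR : realType.
Local Notation C := RR[i].

(** Quotient-free form of differentiability: h = 0 is allowed, so increments of one function can be
    substituted into the estimate of another. *)
Lemma is_derive_epsP (F : RR -> RR) (t d : RR) :
  is_derive t 1 F d <-> forall e : RR, 0 < e -> exists2 r : RR, 0 < r &
    forall h, `|h| < r -> `|F (t + h) - F t - h * d| <= e * `|h|.
Proof.
split=> [[dF vF] e e0|H].
  have : h^-1 *: ((F \o shift t) (h *: (1:RR)) - F t) @[h --> 0^'] --> d.
    by rewrite -vF; exact: dF.
  move=> /cvgrPdist_lt/(_ e e0); rewrite near_withinE => /nbhs_ballP[r /= r0 Hr].
  exists r => // h hr; have [->|h0] := eqVneq h 0.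
    by rewrite addr0 subrr mul0r subrr normr0 mulr0.
  have /Hr : ball (0:RR) r h by rewrite /ball /= sub0r normrN.
  move=> /(_ h0) /=; rewrite /GRing.scale /= mulr1 => /ltW H.
  rewrite -ler_pdivrMr ?normr_gt0 // -normfV -normrM.
  rewrite -normrN; apply: le_trans H; rewrite le_eqVlt; apply/orP; left; apply/eqP.
  by congr `|_|; rewrite (addrC h); field.
have L : h^-1 *: ((F \o shift t) (h *: (1:RR)) - F t) @[h --> 0^'] --> d.
  apply/cvgrPdist_lt => e e0; have e2 : 0 < e / 2 by rewrite divr_gt0.
  have [r r0 Hr] := H _ e2.
  rewrite near_withinE; apply/nbhs_ballP; exists r => //= h.
  rewrite /ball /= sub0r normrN => /Hr {}Hr h0.
  apply: (@le_lt_trans _ _ (e/2)); last by rewrite ltr_pdivrMr // ltr_pMr // ltr1n.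
  rewrite /GRing.scale /= mulr1 -normrN.
  rewrite -(ler_pM2r (_ : 0 < `|h|)) ?normr_gt0 // -normrM; apply: le_trans Hr.
  rewrite le_eqVlt; apply/orP; left; apply/eqP.
  by congr `|_|; rewrite (addrC h); field.
by split; [apply/cvg_ex; exists d|exact: cvg_lim].
Qed.

Lemma complex_derive_eps (f : C -> C) (z d : C) :
  is_derive (z : C^o) 1 (f : C^o -> C^o) d ->
  forall e : RR, 0 < e -> exists2 r : RR, 0 < r &
    forall h, cabs h < r -> cabs (f (z + h) - f z - h * d) <= e * cabs h.
Proof.
move=> [df vf] e e0.
have : (fun h : C^o => h^-1 *: (((f : C^o -> C^o) \o shift (z : C^o)) (h *: (1:C^o))
  - f z) : C^o) @ (0 : C^o)^' --> (d : C^o).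
  by rewrite -vf; exact: df.
have e0' : 0 < e%:C by rewrite ltcR.
move=> /cvgrPdist_lt/(_ _ e0'); rewrite near_withinE => /nbhs_ballP[r /= r0 Hr].
(* The radius of a ball of [C] is a complex number; being positive it is real. *)
have rE : r = (complex.Re r)%:C.
  by move: r0; rewrite ltcE => /andP[/eqP ri _]; apply: complex_ext.
exists (complex.Re r); first by move: r0; rewrite ltcE => /andP[].
move=> h hr; have [->|h0] := eqVneq h 0.
  by rewrite addr0 subrr mul0r subrr cabs0 mulr0.
have /Hr : ball (0:C^o) r h by rewrite /ball /= sub0r normrN norm_cabs rE ltcR.
move=> /(_ h0) /=; rewrite /GRing.scale /= mulr1 norm_cabs ltcR => /ltW H.
rewrite -ler_pdivrMr ?cabs_gt0 // -cabsV -cabsM.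
rewrite -cabsN; apply: le_trans H; rewrite le_eqVlt; apply/orP; left; apply/eqP.
by congr cabs; rewrite (addrC h); field.
Qed.

Lemma is_cderive_epsP (f : RR -> C) (t : RR) (d : C) :
  is_cderive f t d <-> forall e : RR, 0 < e -> exists2 r : RR, 0 < r &
    forall h, `|h| < r -> cabs (f (t + h) - f t - h%:C * d) <= e * `|h|.
Proof.
split=> [[/is_derive_epsP h1 /is_derive_epsP h2] e e0|H].
  have e2 : 0 < e / 2 by rewrite divr_gt0.
  have [r1 r10 H1] := h1 _ e2; have [r2 r20 H2] := h2 _ e2.
  exists (Order.min r1 r2) => [|h]; first by rewrite lt_min r10.
  rewrite lt_min => /andP[/H1 {}H1 /H2 {}H2].
  apply: le_trans (cabs_le _) _; rewrite !ReImE /= !mul0r subr0 addr0.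
  by rewrite (splitr e) mulrDl lerD.
split; apply/is_derive_epsP => e e0; have [r r0 Hr] := H _ e0; exists r => // h /Hr {}Hr.
  apply: le_trans Hr; apply: le_trans (Re_le_cabs _).
  by rewrite !ReImE /= !mul0r subr0.
apply: le_trans Hr; apply: le_trans (Im_le_cabs _).
by rewrite !ReImE /= !mul0r addr0.
Qed.

(* Complex differentiability as the chain rule along every real curve, which *)
(* reduces all the analysis to real functions of one variable.               *)
Definition cderiv_at (F : C -> C) (z d : C) :=
  forall (g : RR -> C) t e, g t = z -> is_cderive g t e ->
    is_cderive (F \o g) t (e * d).

(** The error of the composite splits into the error of f at the increment k of g and d times the
    error of g; the first is controlled because k is at most [K] times [h] in modulus. *)
Lemma cderiv_at_holo (f : C -> C) (z d : C) :
  is_derive (z : C^o) 1 (f : C^o -> C^o) d -> cderiv_at f z d.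
Proof.
move=> /complex_derive_eps H g t e gt /is_cderive_epsP G;
  apply/is_cderive_epsP => eps eps0.
(* [K] is a local Lipschitz constant of g at t. Adding 1 here and to [cabs d] keeps both
   denominators positive. *)
set K := cabs e + 1; have K0 : 0 < K by rewrite ltr_wpDl ?cabs_ge0.
have M0 : 0 < cabs d + 1 by rewrite ltr_wpDl ?cabs_ge0.
have e2 : 0 < eps / 2 by rewrite divr_gt0.
have [r1 r10 H1] := H (eps / 2 / K) (divr_gt0 e2 K0).
have [r2 r20 H2] := G 1 ltr01.
have [r3 r30 H3] := G (eps / 2 / (cabs d + 1)) (divr_gt0 e2 M0).
exists (Order.min (r1 / K) (Order.min r2 r3)) => [|h].
  by rewrite !lt_min r20 r30 divr_gt0.
rewrite !lt_min => /and3P[hr1 /H2 {}H2 /H3 {}H3].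
set k := g (t + h) - g t.
have kh : cabs k <= K * `|h|.
  rewrite -[k](subrK (h%:C * e)) (le_trans (cabsD _ _)) // cabsM cabs_real /K mulrDl.
  by rewrite addrC; apply: lerD => //; rewrite mulrC.
have kr : cabs k < r1.
  by apply: le_lt_trans kh _; rewrite mulrC -ltr_pdivlMr.
have {}H1 := H1 _ kr.
have -> : (f \o g) (t + h) - (f \o g) t - h%:C * (e * d) =
  (f (z + k) - f z - k * d) + (k - h%:C * e) * d.
  rewrite /= /k -gt (addrC (g t)) subrK; ring.
apply: le_trans (cabsD _ _) _; rewrite [leRHS](_ : _ = eps / 2 * `|h| + eps / 2 *
  `|h|); last by field.
apply: lerD.
  apply: le_trans H1 _.
  have := ler_wpM2l (ltW (divr_gt0 e2 K0)) kh.
  by move/le_trans; apply; rewrite mulrA divfK // gt_eqF.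
rewrite cabsM; have := ler_wpM2r (cabs_ge0 d) H3; move/le_trans; apply.
have q : cabs d / (cabs d + 1) <= 1 by rewrite ler_pdivrMr // mul1r lerDl.
rewrite [leLHS](_ : _ = (eps / 2 * `|h|) * (cabs d / (cabs d + 1))).
  by rewrite -[leRHS]mulr1 ler_wpM2l // mulr_ge0 // ltW.
by field; rewrite gt_eqF.
Qed.

Lemma cderiv_at_eq (F : C -> C) z d e : cderiv_at F z d -> d = e -> cderiv_at F z e.
Proof. by move=> h <-. Qed.
Lemma cderiv_at_ext (F G : C -> C) z d : F =1 G -> cderiv_at F z d -> cderiv_at G z d.
Proof. by move=> fg; have -> : G = F by apply/funext => x; rewrite fg. Qed.
Lemma cderiv_at_cst c z : cderiv_at (fun=> c) z 0.
Proof. by move=> g t e _ _; rewrite mulr0; exact: is_cderive_cst. Qed.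
Lemma cderiv_at_id z : cderiv_at id z 1.
Proof. by move=> g t e _; rewrite mulr1. Qed.
Lemma cderiv_atD F G z d e : cderiv_at F z d -> cderiv_at G z e ->
  cderiv_at (fun x => F x + G x) z (d + e).
Proof.
by move=> f g h t k ht hk; rewrite mulrDr; apply: is_cderiveD; [exact: f|exact: g].
Qed.
Lemma cderiv_atM F G z d e : cderiv_at F z d -> cderiv_at G z e ->
  cderiv_at (fun x => F x * G x) z (d * G z + F z * e).
Proof.
move=> f g h t k ht hk.
apply: is_cderive_eq (is_cderiveM (f _ _ _ ht hk) (g _ _ _ ht hk)) _.
by rewrite /= ht; ring.
Qed.
Lemma cderiv_atZ c F z d : cderiv_at F z d -> cderiv_at (fun x => c * F x) z (c * d).
Proof.
move=> f h t k ht hk.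
by apply: is_cderive_eq (is_cderiveZ c (f _ _ _ ht hk)) _; rewrite mulrCA.
Qed.
Lemma cderiv_at_sum n (F : 'I_n -> C -> C) z d : (forall i, cderiv_at (F i) z (d i)) ->
  cderiv_at (fun x => \sum_i F i x) z (\sum_i d i).
Proof.
move=> f h t k ht hk.
by rewrite mulr_sumr; apply: (@is_cderive_sum _ n (fun i => F i \o h)) => i; apply: f.
Qed.
Lemma cderiv_at_cexp F z d : cderiv_at F z d ->
  cderiv_at (fun x => cexp (F x)) z (d * cexp (F z)).
Proof.
move=> f h t k ht hk.
by apply: is_cderive_eq (is_cderive_cexp (f _ _ _ ht hk)) _; rewrite /= ht mulrA.
Qed.
Lemma cderiv_at_opp F z d : cderiv_at F (- z) d -> cderiv_at (fun x => F (- x)) z (- d).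
Proof.
move=> f h t k ht hk.
apply: is_cderive_eq (f (fun x => - h x) t (- k) _ _) _.
- by rewrite ht.
- exact: is_cderiveN.
- by rewrite mulNr mulrN.
Qed.

Lemma is_derive_cts (f : RR -> RR) (t d : RR)
  : is_derive t 1 f d -> {for t, continuous f}.
Proof. by case=> df _; apply: differentiable_continuous; apply/derivable1_diffP. Qed.

(** By the mean value theorem the difference quotient at t is a value of g at an intermediate point,
    and g is continuous at t. *)
Lemma is_derive_removable (f g : RR -> RR) (t : RR) :
  (forall x, x != t -> is_derive x 1 f (g x)) ->
  {for t, continuous f} -> {for t, continuous g} -> is_derive t 1 f (g t).
Proof.
move=> df cf cg; apply/is_derive_epsP => e e0.
move: cg => /cvgrPdist_lt/(_ e e0)/nbhs_ballP[r /= r0 Hr].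
have cont : continuous f.
  by move=> x; have [->//|/df] := eqVneq x t; exact: is_derive_cts.
exists r => // h hr.
have [->|h0] := eqVneq h 0; first by rewrite addr0 subrr mul0r subrr normr0 mulr0.
have key c : `|t - c| < r -> f (t + h) - f t = g c * h ->
    `|f (t + h) - f t - h * g t| <= e * `|h|.
  move=> /Hr; rewrite /= => gc ->.
  by rewrite [h * _]mulrC -mulrBl normrM ler_wpM2r // distrC ltW.
have [hp|hn] := ltP 0 h.
  have lt : t < t + h by rewrite ltrDl.
  have [|c] := MVT (f := f) (df := g) lt _ (continuous_subspaceT cont).
    by move=> x; rewrite in_itv /= => /andP[tx _]; apply: df; rewrite gt_eqF.
  rewrite in_itv /= => /andP[tc ct] E; apply: (key c).
    move: hr; rewrite gtr0_norm // => hr.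
    by rewrite ltr0_norm ?subr_lt0 //; lra.
  by rewrite E; congr (_ * _); ring.
have {}hn : h < 0 by rewrite lt_neqAle h0.
have lt : t + h < t by lra.
have [|c] := MVT (f := f) (df := g) lt _ (continuous_subspaceT cont).
  by move=> x; rewrite in_itv /= => /andP[_ tx]; apply: df; rewrite lt_eqF.
rewrite in_itv /= => /andP[tc ct] E; apply: (key c).
  move: hr; rewrite ltr0_norm // => hr.
  by rewrite gtr0_norm ?subr_gt0 //; lra.
by rewrite -opprB E; ring.
Qed.

End Bridge.

(** * Gronwall's inequality *)

Section Gronwall.
Variable RR : realType.
Local Notation C := RR[i].
Variables (N : nat) (a : RR -> 'I_N -> 'I_N -> C) (f : 'I_N -> RR -> C) (eps : RR).
Hypothesis df : forall (t : RR) k, 0 <= t <= 1 ->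
  is_cderive (f k) t (\sum_l a t k l * f l t).
Hypothesis a_le : forall (t : RR) k l, 0 <= t <= 1 -> cabs (a t k l) <= eps.
Let n (t : RR) := \sum_k cabs (f k t) ^+ 2.
Let K := 2 * eps * N%:R.

Let df_le (t : RR) k : 0 <= t <= 1 ->
  cabs (\sum_l a t k l * f l t) <= \sum_l eps * cabs (f l t).
Proof.
move=> t01; apply: le_trans (cabs_sum _ _) _; apply: ler_sum => l _.
by rewrite cabsM ler_wpM2r ?cabs_ge0 // a_le.
Qed.

(** The derivative is the sum of 2 Re (conj f_k f_k'). Bounding 2 |f_k| |f_l| by |f_k|^2 + |f_l|^2
    and summing over k and l yields the factor 2 eps N. *)
Let dn (t : RR) : 0 <= t <= 1 -> exists2 d : RR, is_derive t 1 n d & d <= K * n t.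
Proof.
move=> t01; set D := fun k => \sum_l a t k l * f l t.
exists (\sum_k (2 * (complex.Re (f k t) * complex.Re (D k) + complex.Im (f k t)
  * complex.Im (D k)))).
  rewrite (_ : n = \sum_k (fun t => cabs (f k t) ^+ 2)); last first.
    by apply/funext => x; rewrite fct_sumE.
  apply: is_derive_sum => k; have [h1 h2] := df k t01.
  rewrite (_ : (fun t => _) = (fun x => complex.Re (f k x) * complex.Re (f k x))
    + (fun x => complex.Im (f k x) * complex.Im (f k x))).
    have g1 := is_deriveMf h1 h1; have g2 := is_deriveMf h2 h2.
    by apply: is_derive_eq; rewrite /D; ring.
  by apply/funext => x; rewrite cabs_sqr !expr2.
have step k : 2 * (complex.Re (f k t) * complex.Re (D k) + complex.Im (f k t)
  * complex.Im (D k))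
    <= \sum_l eps * (cabs (f k t) ^+ 2 + cabs (f l t) ^+ 2).
  apply: (@le_trans _ _ (2 * (cabs (f k t) * cabs (D k)))).
    rewrite ler_pM2l // -cabsM; have := Re_le_cabs ((f k t)^*%C * D k).
    rewrite cabsM cabsM (_ : cabs (f k t)^*%C = cabs (f k t)); last first.
      by rewrite /cabs; case: (f k t) => x y /=; rewrite sqrrN.
    move/(le_trans (ler_norm _)); apply: le_trans.
    by rewrite cReM; case: (f k t) => x y /=; rewrite mulNr opprK.
  have h : 2 * (cabs (f k t) * cabs (D k)) <= 2 * (cabs (f k t)
    * (\sum_l eps * cabs (f l t))).
    by rewrite ler_pM2l // ler_wpM2l ?cabs_ge0 // df_le.
  apply: le_trans h _; rewrite !mulr_sumr; apply: ler_sum => l _.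
  have e0 : 0 <= eps := le_trans (cabs_ge0 _) (a_le k l t01).
  have := sqr_ge0 (cabs (f k t) - cabs (f l t)) => h.
  rewrite [leLHS](_ : _ = eps * (2 * (cabs (f k t) * cabs (f l t)))); last by ring.
  by rewrite ler_wpM2l //; nra.
apply: le_trans (ler_sum _ (fun k _ => step k)) _.
rewrite le_eqVlt; apply/orP; left; apply/eqP.
have E k : \sum_l eps * (cabs (f k t) ^+ 2 + cabs (f l t) ^+ 2)
    = eps * (cabs (f k t) ^+ 2 * N%:R + n t).
  by rewrite -mulr_sumr big_split /= sumr_const card_ord mulr_natr.
rewrite (eq_bigr _ (fun k _ => E k)) -mulr_sumr big_split /= -mulr_suml.
by rewrite sumr_const card_ord -mulr_natr /K /n; ring.
Qed.

(** The function n(s) e^(-K s) has nonpositive derivative. *)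
Lemma gronwall (t : RR) : 0 <= t <= 1 -> n t <= expR (K * t) * n 0.
Proof.
move=> t01; have [->|t0] := eqVneq t 0; first by rewrite mulr0 expR0 mul1r.
have tpos : 0 < t by rewrite lt_neqAle eq_sym t0; case/andP: t01.
pose h (s : RR) := n s * expR (- K * s).
have dh (s : RR) : 0 <= s <= 1 -> exists2 d : RR, is_derive s 1 h d & d <= 0.
  move=> s01; have [d hd dK] := dn s01.
  have hl : is_derive s 1 (fun s => - K * s) (- K).
    have := is_deriveMf (is_derive_cst (- K) s 1) (is_derive_id s (1 : RR)).
    by move=> h1; apply: is_derive_eq; rewrite mul0r add0r mulr1.
  have hE := is_derive1_comp (is_derive_expR (- K * s)) hl.
  have := is_deriveMf hd hE => h1; eexists; first exact: h1.
  rewrite [leLHS](_ : _ = (d - K * n s) * expR (- K * s)); last by rewrite /=; ring.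
  by rewrite mulr_le0_ge0 ?expR_ge0 // subr_le0.
have sub (s : RR) : s \in `[0, t] -> 0 <= s <= 1.
  by rewrite in_itv /= => /andP[-> st] /=; rewrite (le_trans st) //; case/andP: t01.
have : h t <= h 0.
  have [||c] := @MVT _ h (fun s => 'D_1 h s) 0 t tpos.
  - move=> s; rewrite in_itv /= => /andP[s0 st].
    have [|d hd _] := dh s; first by apply: sub; rewrite in_itv /= !ltW.
    by case: hd => hd _; exact: DeriveDef hd erefl.
  - apply: derivable_within_continuous => s /sub /dh [d hd _]; exact: ex_derive.
  rewrite in_itv /= => /andP[s0 st] E; rewrite -subr_le0 E.
  have [|d hd d0] := dh c; first by apply: sub; rewrite in_itv /= !ltW.
  have -> : 'D_1 h c = d by case: hd.
  by rewrite mulr_le0_ge0 // subr0 ltW.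
rewrite /h mulr0 expR0 mulr1 mulNr expRN => H.
by rewrite mulrC -ler_pdivrMr ?expR_gt0.
Qed.

(** The bound vanishes with [eps], which is what the shrinking arcs require. It comes from |f_l| <=
    1 + |f_l|^2 and the mean value theorem, applied separately to real and imaginary parts, whence
    the factor 2. *)
Lemma gronwall_diff k : 0 <= eps ->
  cabs (f k 1 - f k 0) <= 2 * eps * N%:R * (1 + expR K * n 0).
Proof.
move=> e0.
have n0 : 0 <= n 0 by apply: sumr_ge0 => l _; rewrite sqr_ge0.
have bnd (t : RR) : 0 <= t <= 1 -> cabs (\sum_l a t k l * f l t)
  <= eps * N%:R * (1 + expR K * n 0).
  move=> t01; apply: le_trans (df_le k t01) _.
  rewrite [leRHS](_ : _ = \sum_(l < N) eps * (1 + expR K * n 0)); last first.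
    by rewrite sumr_const card_ord -mulr_natr; ring.
  apply: ler_sum => l _; rewrite ler_wpM2l //.
  have := gronwall t01.
  have : cabs (f l t) ^+ 2 <= n t.
    by rewrite /n (bigD1 l) //= lerDl sumr_ge0 // => i _; rewrite sqr_ge0.
  have : expR (K * t) * n 0 <= expR K * n 0.
    rewrite ler_wpM2r // ler_expR -[leRHS]mulr1 ler_wpM2l //; last by case/andP: t01.
    by rewrite /K !mulr_ge0.
  have := sqr_ge0 (cabs (f l t) - 1); have := cabs_ge0 (f l t); nra.
have mv (F : RR -> RR) (d : RR -> RR)
  : (forall t : RR, 0 <= t <= 1 -> is_derive t 1 F (d t)) ->
    (forall t : RR, 0 <= t <= 1 -> `|d t| <= eps * N%:R * (1 + expR K * n 0)) ->
    `|F 1 - F 0| <= eps * N%:R * (1 + expR K * n 0).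
  move=> hF hd; have [||c] := @MVT _ F d 0 1 ltr01.
  - by move=> s; rewrite in_itv /= => /andP[s0 st]; apply: hF; rewrite !ltW.
  - apply: derivable_within_continuous => s; rewrite in_itv /= => s01.
    by have := hF _ s01 => h; exact: ex_derive.
  rewrite in_itv /= => /andP[s0 st] ->; rewrite subr0 mulr1.
  by apply: hd; rewrite !ltW.
set B := eps * N%:R * (1 + expR K * n 0).
rewrite [leRHS](_ : _ = B + B); last by rewrite /B; ring.
apply: le_trans (cabs_le _) _; rewrite !ReImE; apply: lerD.
  apply: (mv (fun t => complex.Re (f k t))
    (fun t => complex.Re (\sum_l a t k l * f l t))) => t t01; first by case: (df k t01).
  exact: le_trans (Re_le_cabs _) (bnd _ t01).
apply: (mv (fun t => complex.Im (f k t))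
  (fun t => complex.Im (\sum_l a t k l * f l t))) => t t01; first by case: (df k t01).
exact: le_trans (Im_le_cabs _) (bnd _ t01).
Qed.

End Gronwall.

(** * Logarithm and sectors *)

Section Logarithm.
Variable RR : realType.
Local Notation C := RR[i].
Implicit Types (z w : C) (b : bool).

Lemma unit_abscissa z : z != 0 -> -1 <= complex.Re z / cabs z <= 1.
Proof.
rewrite -cabs_gt0 => z0; rewrite -ler_norml normrM normfV (gtr0_norm z0).
by rewrite ler_pdivrMr // mul1r Re_le_cabs.
Qed.

Lemma unit_abscissa_lt z : complex.Im z != 0 -> -1 < complex.Re z / cabs z < 1.
Proof.
move=> z0; have c0 : 0 < cabs z by rewrite cabs_gt0; apply: contraNneq z0 => ->.
rewrite -ltr_norml normrM normfV (gtr0_norm c0) ltr_pdivrMr // mul1r.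
rewrite -ltr_sqr ?nnegrE ?cabs_ge0 // cabs_sqr real_normK ?num_real // ltrDl.
by rewrite lt_def sqr_ge0 andbT sqrf_eq0.
Qed.

Lemma carg_scale (a : RR) z : 0 < a -> carg (a%:C * z) = carg z.
Proof.
move=> a0; have rE : complex.Re (a%:C * z) / cabs (a%:C * z) = complex.Re z / cabs z.
  rewrite cabsM cabs_real gtr0_norm // cReM /= mul0r subr0 invfM mulrACA.
  by rewrite mulfV ?mul1r // gt_eqF.
by rewrite /carg rE cImM /= mul0r addr0 pmulr_rge0.
Qed.

Lemma carg_lt_pi z : 0 < complex.Re z \/ complex.Im z != 0 -> `|carg z| < pi.
Proof.
move=> H; have z0 : z != 0.
  by case: H => h; apply: contraTneq h => ->; rewrite /= ?ltxx ?eqxx.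
have /andP[u1 u2] := unit_abscissa z0.
have -> : `|carg z| = acos (complex.Re z / cabs z).
  rewrite /carg; case: ifP => _; rewrite ?normrN ger0_norm // acos_ge0 ?u1 //.
apply: acos_ltpi; rewrite u2 andbT.
case: H => [h|/unit_abscissa_lt/andP[] //].
by apply: (@lt_le_trans _ _ 0); rewrite ?ltrN10 // divr_ge0 ?cabs_ge0 // ltW.
Qed.

Lemma clog_scale (a : RR) z : 0 < a -> z != 0 -> clog (a%:C * z) = (ln a)%:C + clog z.
Proof.
move=> a0 z0; rewrite /clog carg_scale // cabsM cabs_real gtr0_norm // lnM ?posrE
  ?cabs_gt0 //.
by apply: complex_ext; rewrite !ReImE //= add0r.
Qed.

Lemma blog_scale b (a : RR) z : 0 < a -> z != 0 ->
  blog b (a%:C * z) = (ln a)%:C + blog b z.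
Proof.
move=> a0 z0; rewrite /blog mulrCA clog_scale ?addrA //.
by rewrite mulf_neq0 // expf_neq0 // oppr_eq0 oner_neq0.
Qed.

Lemma clogN z : 0 < complex.Im z -> clog (- z) = clog z - (0 +i* pi).
Proof.
move=> z0; rewrite /clog cabsN; apply: complex_ext; rewrite !ReImE /= ?subr0 //.
rewrite /carg !ReImE (ltW z0) oppr_ge0 leNgt z0 /= cabsN mulNr acosN ?opprB //.
by apply: unit_abscissa; apply: contraTneq z0 => ->; rewrite ltxx.
Qed.

(** The branch on H_- is reached clockwise from H_+, so above the real axis it lags by a full turn.
    This is the origin of the diagonal of S_+. *)
Lemma blog_true_false z : 0 < complex.Im z ->
  blog true z = blog false z - (0 +i* (pi *+ 2)).
Proof.
move=> z0; rewrite /blog expr1 mulN1r expr0 mul1r clogN // mulr1n mulr0n.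
by apply: complex_ext; rewrite !ReImE /=; ring.
Qed.

(** Both branches reduce to [clog (- z)], so the relation holds for every z, cuts included. *)
Lemma blog_opp z : blog false (- z) = blog true z + (0 +i* pi).
Proof.
rewrite /blog expr0 mul1r expr1 mulN1r mulr1n mulr0n.
by apply: complex_ext; rewrite !ReImE /=; ring.
Qed.

(** Above the real axis the argument is acos (x / r), and the square root in the derivative of acos
    is y / r. *)
Lemma is_cderive_clog (g : RR -> C) t e : 0 < complex.Im (g t) -> is_cderive g t e ->
  is_cderive (fun x => clog (g x)) t (e / g t).
Proof.
move=> y0 [dx dy].
set x := fun s => complex.Re (g s); set y := fun s => complex.Im (g s).
have r0 : 0 < cabs (g t).
  by rewrite cabs_gt0; apply: contraTneq y0 => ->; rewrite ltxx.
have r2 : cabs (g t) * cabs (g t) = x t ^+ 2 + y t ^+ 2 by rewrite -expr2 cabs_sqr.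
have r2' : x t ^+ 2 + y t ^+ 2 != 0 by rewrite -r2 mulf_neq0 // gt_eqF.
set r := fun s => cabs (g s).
have rn : r t != 0 by rewrite gt_eqF.
have dr : is_derive t 1 r ((x t * complex.Re e + y t * complex.Im e) / r t).
  have dN : is_derive t 1 (fun s => x s ^+ 2 + y s ^+ 2)
    (2 * (x t * complex.Re e + y t * complex.Im e)).
    rewrite (_ : (fun s => _) = (fun s => x s * x s) + (fun s => y s * y s)).
      have h1 := is_deriveMf dx dx; have h2 := is_deriveMf dy dy.
      by apply: is_derive_eq; rewrite /x /y; ring.
    by apply/funext => s; rewrite !expr2.
  have N0 : 0 < x t ^+ 2 + y t ^+ 2 by rewrite -r2 mulr_gt0.
  have := @is_derive1_comp RR Num.sqrt (fun s => x s ^+ 2 + y s ^+ 2)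
    t _ _ (is_derive1_sqrt N0) dN => h.
  apply: is_derive_eq; rewrite -/(cabs (g t)) -/(r t); field.
  exact: rn.
split.
  have := @is_derive1_comp RR (@ln RR) r t _ _ (is_derive1_ln r0) dr => h.
  apply: is_derive_eq; rewrite cReM cReV cImV -/(x t) -/(y t) -/(r t) -r2 -/(r t); field.
  exact: rn.
have drV := is_deriveV rn dr.
have hu := unit_abscissa_lt (lt0r_neq0 y0).
have du := is_deriveMf dx drV.
have := @is_derive1_comp RR (@acos RR) (fun s => x s * (r s)^-1)
  t _ _ (is_derive1_acos hu) du => h.
apply: is_derive_near (is_derive_eq h _).
  have cy := is_derive_cts dy.
  have : \forall s \near t, 0 < y s.
    by apply: (cy [set v | 0 < v]); apply: lt_nbhsr.
  by apply: filterS => s ys; rewrite /clog /= /carg (ltW ys).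
have sq : Num.sqrt (1 - (x t / r t) ^+ 2) = y t / r t.
  rewrite (_ : 1 - _ = (y t / r t) ^+ 2).
    by rewrite sqrtr_sqr ger0_norm // divr_ge0 ?ltW.
  have E2 : y t ^+ 2 = r t * r t - x t ^+ 2 by rewrite r2; ring.
  rewrite [RHS](_ : _ = y t ^+ 2 / (r t * r t)); last by field.
  by rewrite E2; field.
rewrite -/(x t) -/(r t) sq cImM cReV cImV -/(x t) -/(y t) /GRing.scale /=.
have yn : y t != 0 by rewrite gt_eqF.
rewrite -r2 -/(r t).
have E : complex.Re e * (r t * r t) - x t * (x t * complex.Re e + y t * complex.Im e)
   = y t * (y t * complex.Re e - x t * complex.Im e) by rewrite r2; ring.
rewrite [LHS](_ : _ = - (complex.Re e * (r t * r t)
  - x t * (x t * complex.Re e + y t * complex.Im e)) / (y t * (r t * r t))).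
  by rewrite E; field; rewrite rn yn.
by field; rewrite rn yn.
Qed.

Lemma cderiv_at_clog z : 0 < complex.Im z -> cderiv_at (@clog RR) z z^-1.
Proof. by move=> z0 g t e gt h; rewrite -gt; apply: is_cderive_clog; rewrite ?gt. Qed.

Lemma supersectorP b z : 0 < complex.Re ((-1) ^+ b * z) \/ complex.Im z != 0 ->
  supersector b z.
Proof.
move=> H; split.
  by case: H => h; apply: contraTneq h => ->; rewrite ?mulr0 /= ?ltxx ?eqxx.
rewrite -splitr; apply: carg_lt_pi; case: H; [by left|right].
by case: b => //=; rewrite ?expr1 ?mulN1r ?mul1r ?cImN ?oppr_eq0.
Qed.

(** Asymptotic expansions are uniform only on proper subsectors; the argument is constant on a ray,
    so a single subsector contains all of it. *)
Lemma sector_ray b w : 0 < complex.Re ((-1) ^+ b * w) \/ complex.Im w != 0 ->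
  exists2 theta : RR, theta < pi / 2 + pi / 2 &
    forall a : RR, 0 < a -> sector b theta (a%:C * w).
Proof.
move=> H; have [w0 lt] := supersectorP H.
have [theta] : exists theta : RR, `|carg ((-1) ^+ b * w)| < theta < pi / 2 + pi / 2.
  by exists ((`|carg ((-1) ^+ b * w)| + (pi / 2 + pi / 2)) / 2);
    rewrite midf_lt // midf_lt.
move=> /andP[h1 h2]; exists theta => // a a0; split.
  by rewrite mulf_neq0 // -cabs_gt0 cabs_real normr_gt0 gt_eqF.
by rewrite mulrCA carg_scale.
Qed.

End Logarithm.

(** * Asymptotics of sequences *)

Section Sequences.
Variable RR : realType.
Local Notation C := RR[i].
Implicit Types x y : nat -> C.

Definition seqO (k : nat) x := exists K : RR, exists n0 : nat,
  forall n, (n0 <= n)%N -> cabs (x n) * n%:R ^+ k <= K.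
(** Convergence with rate 1/n. Both sources of limits, truncated expansions on rays and arcs of
    radius 1/(n+1), have this rate, and limits then become an instance of [seqO]. *)
Definition tends x (a : C) := seqO 1 (fun n => x n - a).
Definition rapid x := forall k, seqO k x.
Definition moderate x := exists M : nat, exists K : RR, exists n0 : nat,
  forall n, (n0 <= n)%N -> cabs (x n) <= K * n%:R ^+ M.

Lemma ltr_archi (r : RR) : r < (Num.bound `|r|)%:R.
Proof. by apply: le_lt_trans (ler_norm r) _; apply: archi_boundP. Qed.

Lemma seqO_evt k x y (n0 : nat) : (forall n, (n0 <= n)%N -> x n = y n)
  -> seqO k x -> seqO k y.
Proof.
move=> xy [K [n1 H]]; exists K; exists (maxn n0 n1) => n;
  rewrite geq_max => /andP[/xy <-]; exact: H.
Qed.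

Lemma seqO_ext k x y : x =1 y -> seqO k x -> seqO k y.
Proof. by move=> xy; apply: (@seqO_evt k x y 0). Qed.

Lemma seqOD k x y : seqO k x -> seqO k y -> seqO k (fun n => x n + y n).
Proof.
move=> [K [n0 H]] [K' [n1 H']]; exists (K + K'); exists (maxn n0 n1) => n.
rewrite geq_max => /andP[/H {}H /H' {}H'].
apply: le_trans (lerD H H'); rewrite -mulrDl ler_wpM2r ?exprn_ge0 //; exact: cabsD.
Qed.

Lemma seqOM k l x y : seqO k x -> seqO l y -> seqO (k + l) (fun n => x n * y n).
Proof.
move=> [K [n0 H]] [K' [n1 H']]; exists (K * K'); exists (maxn n0 n1) => n.
rewrite geq_max => /andP[/H {}H /H' {}H'].
rewrite cabsM exprD mulrACA ler_pM // mulr_ge0 ?cabs_ge0 ?exprn_ge0 //.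
Qed.

Lemma seqO0 k : seqO k (fun=> 0).
Proof. by exists 0; exists 0%N => n _; rewrite cabs0 mul0r. Qed.

Lemma seqO_cst (a : C) : seqO 0 (fun=> a).
Proof. by exists (cabs a); exists 0%N => n _; rewrite expr0 mulr1. Qed.

Lemma seqOZ k (a : C) x : seqO k x -> seqO k (fun n => a * x n).
Proof. exact: (seqOM (seqO_cst a)). Qed.

Lemma seqON k x : seqO k x -> seqO k (fun n => - x n).
Proof. by move=> h; apply: seqO_ext (seqOZ (-1) h) => n; rewrite mulN1r. Qed.

Lemma seqO_sum k (I : finType) (x : I -> nat -> C) :
  (forall i, seqO k (x i)) -> seqO k (fun n => \sum_i x i n).
Proof.
move=> h; suff H (s : seq I) : seqO k (fun n => \sum_(i <- s) x i n) by exact: H.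
elim: s => [|i s IH].
  by apply: seqO_ext (seqO0 k) => n; rewrite big_nil.
by apply: seqO_ext (seqOD (h i) IH) => n; rewrite big_cons.
Qed.

Lemma seqO_le k l x : (l <= k)%N -> seqO k x -> seqO l x.
Proof.
move=> lk [K [n0 H]]; exists K; exists (maxn n0 1) => n.
rewrite geq_max => /andP[/H {}H n1]; apply: le_trans H.
by rewrite ler_wpM2l ?cabs_ge0 // ler_weXn2l // ler1n.
Qed.

Lemma seqO1_cst (a : C) : seqO 1 (fun=> a) -> a = 0.
Proof.
move=> [K [n0 H]]; apply/eqP; rewrite -cabs_eq0 eq_le cabs_ge0 andbT leNgt;
  apply/negP => a0.
set n := maxn n0 (Num.bound `|K / cabs a|).
have := H n (leq_maxl _ _); apply/negP; rewrite -ltNge expr1 mulrC -ltr_pdivrMr //.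
apply: lt_le_trans (_ : (Num.bound `|K / cabs a|)%:R <= _);
  last by rewrite ler_nat leq_maxr.
exact: ltr_archi.
Qed.

Lemma rapid_cst (a : C) : rapid (fun=> a) -> a = 0.
Proof. by move=> /(_ 1%N)/seqO1_cst. Qed.

Lemma rapid_evt x y (n0 : nat) : (forall n, (n0 <= n)%N -> x n = y n)
  -> rapid x -> rapid y.
Proof. by move=> xy H k; exact: seqO_evt xy (H k). Qed.

Lemma rapidD x y : rapid x -> rapid y -> rapid (fun n => x n + y n).
Proof. by move=> h h' k; exact: seqOD. Qed.

Lemma rapidM_seqO x y : rapid x -> seqO 0 y -> rapid (fun n => x n * y n).
Proof. by move=> h h' k; rewrite -(addn0 k); exact: seqOM. Qed.

Lemma rapidM x y : rapid x -> moderate y -> rapid (fun n => x n * y n).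
Proof.
move=> h [M [K [n0 H]]] k; have [K' [n1 H']] := h (k + M)%N.
exists (K' * K); exists (maxn (maxn n0 n1) 1) => n.
rewrite !geq_max => /andP[/andP[/H {}H /H' {}H'] n1'].
rewrite cabsM.
have nM : 0 < n%:R ^+ M :> RR by rewrite exprn_gt0 // ltr0n.
have K0 : 0 <= K by rewrite -(pmulr_lge0 _ nM) (le_trans (cabs_ge0 _) H).
apply: (@le_trans _ _ (cabs (x n) * n%:R ^+ (k + M) * K)); last by rewrite ler_wpM2r.
rewrite exprD [leRHS](_ : _ = cabs (x n) * n%:R ^+ k * (K * n%:R ^+ M)); last by ring.
by rewrite mulrAC ler_wpM2l // mulr_ge0 ?cabs_ge0 ?exprn_ge0.
Qed.

Lemma rapid_sum (I : finType) (x : I -> nat -> C) :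
  (forall i, rapid (x i)) -> rapid (fun n => \sum_i x i n).
Proof. by move=> h k; apply: seqO_sum => i; exact: h. Qed.

Lemma moderateM x y : moderate x -> moderate y -> moderate (fun n => x n * y n).
Proof.
move=> [M [K [n0 H]]] [M' [K' [n1 H']]]; exists (M + M')%N; exists (K * K');
  exists (maxn n0 n1) => n.
rewrite geq_max => /andP[/H {}H /H' {}H'].
by rewrite cabsM exprD mulrACA ler_pM ?cabs_ge0.
Qed.

Lemma moderate_seqO x : seqO 0 x -> moderate x.
Proof.
by move=> [K [n0 H]]; exists 0%N; exists K; exists n0 => n /H; rewrite expr0 !mulr1.
Qed.

(** Raise x <= e^x with x = n e / (k + 1) to the power k: the exponent k / (k + 1) n e is absorbed
    by the decay e^(- n e). *)
Lemma rapid_cexp (z : C) : complex.Re z < 0 -> rapid (fun n => cexp (n%:R * z)).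
Proof.
move=> z0 k; set e := - complex.Re z; have e0 : 0 < e by rewrite oppr_gt0.
(* Dividing by [k.+1] rather than [k] covers the case k = 0. *)
exists ((k.+1%:R / e) ^+ k); exists 0%N => n _.
rewrite cabs_cexp cReM Re_nat Im_nat mul0r subr0.
have ke : 0 < k.+1%:R / e by rewrite divr_gt0 // ltr0n.
have h : n%:R <= k.+1%:R / e * expR (n%:R * e / k.+1%:R).
  set X := n%:R * e / k.+1%:R.
  have XE : k.+1%:R / e * X = n%:R.
    have kn : (k.+1%:R : RR) != 0 by rewrite pnatr_eq0.
    by rewrite /X; move: (k.+1%:R) kn => kk kn; field; rewrite kn gt_eqF.
  rewrite -[leLHS]XE ler_wpM2l ?(ltW ke) //.
  by have := expR_ge1Dx X; apply: le_trans; rewrite lerDr.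
have {h} : n%:R ^+ k <= (k.+1%:R / e) ^+ k * expR (n%:R * e / k.+1%:R) ^+ k.
  by rewrite -exprMn lerXn2r // nnegrE ?ler0n // mulr_ge0 ?expR_ge0 ?ltW.
rewrite -expRM_natr => h.
rewrite mulrC -ler_pdivlMr ?expR_gt0 // -expRN; apply: le_trans h _.
rewrite ler_wpM2l ?exprn_ge0 ?(ltW ke) // ler_expR.
rewrite -mulrN -/e -!mulrA ler_wpM2l // -[leRHS]mulr1 ler_wpM2l ?(ltW e0) //.
by rewrite mulrC ler_pdivrMr ?ltr0n // mul1r ler_nat.
Qed.

Lemma seqO_cexp (z : C) : complex.Re z <= 0 -> seqO 0 (fun n => cexp (n%:R * z)).
Proof.
move=> z0; exists 1; exists 0%N => n _; rewrite expr0 mulr1 cabs_cexp cReM Re_nat Im_nat.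
by rewrite mul0r subr0 -expR0 ler_expR mulr_ge0_le0.
Qed.

Lemma moderate_power (a : C) : moderate (fun n => cexp ((ln n%:R)%:C * a)).
Proof.
set M := Num.bound `|complex.Re a|; exists M; exists 1; exists 1%N => n n1.
rewrite mul1r cabs_cexp cReM /= mul0r subr0.
have n0 : 0 < n%:R :> RR by rewrite ltr0n.
rewrite -[in leRHS](@lnK _ n%:R)
  ?posrE // -expRM_natr ler_expR ler_wpM2l ?ln_ge0 ?ler1n //.
exact/ltW/ltr_archi.
Qed.

Lemma tends_cst (a : C) : tends (fun=> a) a.
Proof. by apply: seqO_ext (seqO0 1) => n; rewrite subrr. Qed.

Lemma tends_seqO x a : tends x a -> seqO 0 x.
Proof.
move=> h; apply: seqO_ext (seqOD (seqO_le (leq0n 1) h) (seqO_cst a)) => n.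
by rewrite subrK.
Qed.

Lemma tendsD x y a b : tends x a -> tends y b -> tends (fun n => x n + y n) (a + b).
Proof. by move=> h h'; apply: seqO_ext (seqOD h h') => n; rewrite opprD addrACA. Qed.

Lemma tendsM x y a b : tends x a -> tends y b -> tends (fun n => x n * y n) (a * b).
Proof.
move=> h h'; have h1 : seqO 1 (fun n => (x n - a) * y n).
  by rewrite -[1%N]addn0; apply: seqOM => //; exact: tends_seqO h'.
by apply: seqO_ext (seqOD h1 (seqOZ a h')) => n; ring.
Qed.

Lemma tends_sum (I : finType) (x : I -> nat -> C) (a : I -> C) :
  (forall i, tends (x i) (a i)) -> tends (fun n => \sum_i x i n) (\sum_i a i).
Proof.
by move=> h; apply: seqO_ext (seqO_sum h) => n; rewrite sumrB.
Qed.

Lemma tends_prod (I : finType) (x : I -> nat -> C) (a : I -> C) :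
  (forall i, tends (x i) (a i)) -> tends (fun n => \prod_i x i n) (\prod_i a i).
Proof.
move=> h; suff H (s : seq I) : tends (fun n => \prod_(i <- s) x i n) (\prod_(i <- s)
  a i) by exact: H.
elim: s => [|i s IH].
  by rewrite big_nil; apply: seqO_ext (tends_cst 1) => n; rewrite big_nil.
by rewrite big_cons; apply: seqO_ext (tendsM (h i) IH) => n; rewrite big_cons.
Qed.

Lemma tends_uniq x a b : tends x a -> tends x b -> a = b.
Proof.
move=> h h'; apply/eqP; rewrite eq_sym -subr_eq0; apply/eqP; apply: seqO1_cst.
by apply: seqO_ext (seqOD h (seqON h')) => n; ring.
Qed.

Lemma tends_ge_half x : tends x 1 -> exists n0 : nat, forall n, (n0 <= n)%N -> 2^-1 <=
  cabs (x n).
Proof.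
move=> [K [n0 H]]; exists (maxn n0 (Num.bound `|2 * K|).+1) => n.
rewrite geq_max => /andP[/H {}H n1].
have nK : 2 * K < n%:R.
  apply: lt_le_trans (_ : (Num.bound `|2 * K|)%:R <= _); last by rewrite ler_nat ltnW.
  exact: ltr_archi.
have n0' : 0 < n%:R :> RR by rewrite ltr0n (leq_trans _ n1).
have h : cabs (x n - 1) <= 2^-1.
  rewrite -(ler_pM2r n0'); rewrite expr1 in H; apply: le_trans H _.
  by rewrite ler_pdivlMl // ltW.
have := cabsD (x n) (1 - x n); rewrite addrC subrK cabs1.
rewrite -(cabsN (1 - x n)) opprB => h2.
by lra.
Qed.

Lemma tendsV x : tends x 1 -> tends (fun n => (x n)^-1) 1.
Proof.
move=> h; have [n0 H] := tends_ge_half h.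
have b : seqO 0 (fun n => - (x n)^-1).
  apply: seqON; exists 2; exists n0 => n /H {}H; rewrite expr0 mulr1 cabsV -[leRHS]invrK.
  by rewrite lef_pV2 ?posrE //; apply: lt_le_trans H; rewrite invr_gt0.
have := seqOM b h; rewrite add0n; apply: (@seqO_evt _ _ _ n0) => n /H {}H.
have xn : x n != 0 by rewrite -cabs_gt0; apply: lt_le_trans H; rewrite invr_gt0.
by field.
Qed.

End Sequences.

(** * Entrywise limits of matrix sequences *)

Section MatrixSequences.
Variable RR : realType.
Local Notation C := RR[i].

Definition tends_mx (N : nat) (A : nat -> 'M[C]_N) (B : 'M[C]_N) :=
  forall i j, tends (fun n => A n i j) (B i j).
Definition rapid_mx (N : nat) (A : nat -> 'M[C]_N) :=
  forall i j, rapid (fun n => A n i j).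

Lemma tends_det N (A : nat -> 'M[C]_N) B : tends_mx A B ->
  tends (fun n => \det (A n)) (\det B).
Proof.
move=> h; rewrite /determinant; apply: tends_sum => s; apply: tendsM;
  first exact: tends_cst.
by apply: tends_prod => i; apply: h.
Qed.

Lemma tends_unitmx N (A : nat -> 'M[C]_N) : tends_mx A 1%:M ->
  exists n0 : nat, forall n, (n0 <= n)%N -> A n \in unitmx.
Proof.
move=> h; have := tends_det h; rewrite det1 => /tends_ge_half[n0 H];
  exists n0 => n /H {}H.
by rewrite unitmxE unitfE -cabs_gt0; apply: lt_le_trans H; rewrite invr_gt0.
Qed.

Lemma tends_mulmx N (A A' : nat -> 'M[C]_N) B B' : tends_mx A B -> tends_mx A' B' ->
  tends_mx (fun n => A n *m A' n) (B *m B').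
Proof.
move=> h h' i j; rewrite mxE.
have := tends_sum (fun k => tendsM (h i k) (h' k j)).
by apply: seqO_ext => n; rewrite mxE.
Qed.

(** The inverse is the adjugate over the determinant, both polynomial in the entries, and the
    determinant tends to 1. *)
Lemma tends_invmx N (A : nat -> 'M[C]_N) : tends_mx A 1%:M ->
  tends_mx (fun n => invmx (A n)) 1%:M.
Proof.
move=> h i j; have [n0 H] := tends_unitmx h.
have d := tends_det h; rewrite det1 in d.
have -> : (1%:M : 'M[C]_N) i j = 1 * (\adj (1%:M : 'M[C]_N)) i j.
  have := mul_mx_adj (1%:M : 'M[C]_N); rewrite mul1mx det1 => ->.
  by rewrite mul1r.
have a : tends (fun n => (\adj (A n)) i j) ((\adj (1%:M : 'M[C]_N)) i j).
  rewrite mxE /cofactor; have : tends (fun n => (-1) ^+ (j + i)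
    * \det (row' j (col' i (A n))))
      ((-1) ^+ (j + i) * \det (row' j (col' i (1%:M : 'M[C]_N)))).
    apply: tendsM; first exact: tends_cst.
    apply: tends_det => k l; rewrite !mxE.
    have := h (lift j k) (lift i l); rewrite mxE.
    by apply: seqO_ext => n; rewrite !mxE.
  by apply: seqO_ext => n; rewrite mxE.
have := tendsM (tendsV d) a; apply: (@seqO_evt _ _ _ _ n0) => n /H {}H.
by rewrite /invmx H !mxE.
Qed.

Lemma rapid_mulmxl N (A B : nat -> 'M[C]_N) B' : rapid_mx A -> tends_mx B B' ->
  rapid_mx (fun n => A n *m B n).
Proof.
move=> h h' i j; have : rapid (fun n => \sum_k A n i k * B n k j).
  by apply: rapid_sum => k; apply: rapidM_seqO => //; exact: tends_seqO (h' k j).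
by apply: (@rapid_evt _ _ _ 0) => n _; rewrite mxE.
Qed.

Lemma rapid_mulmxr N (A B : nat -> 'M[C]_N) A' : tends_mx A A' -> rapid_mx B ->
  rapid_mx (fun n => A n *m B n).
Proof.
move=> h h' i j; have : rapid (fun n => \sum_k B n k j * A n i k).
  by apply: rapid_sum => k; apply: rapidM_seqO => //; exact: tends_seqO (h i k).
by apply: (@rapid_evt _ _ _ 0) => n _; rewrite mxE; apply: eq_bigr => k _; rewrite mulrC.
Qed.

Lemma rapid_mxE N (A B : nat -> 'M[C]_N) (n0 : nat) :
  (forall n, (n0 <= n)%N -> A n = B n) -> rapid_mx A -> rapid_mx B.
Proof.
by move=> AB h i j; have := h i j; apply: (@rapid_evt _ _ _ n0) => n /AB ->.
Qed.

Lemma rapid_quotient N (A B : nat -> 'M[C]_N) : tends_mx A 1%:M ->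
  rapid_mx (fun n => B n - A n) -> rapid_mx (fun n => invmx (A n) *m B n - 1%:M).
Proof.
move=> h h'; have [n0 H] := tends_unitmx h.
apply: (rapid_mxE (n0 := n0)) (rapid_mulmxr (tends_invmx h) h') => n /H {}H.
by rewrite mulmxBr mulVmx.
Qed.

(** A^-1 A' - B^-1 B' = A^-1 (A' - B') + A^-1 (B - A) B^-1 B'. *)
Lemma rapid_quotient2 N (A B A' B' : nat -> 'M[C]_N) :
  tends_mx A 1%:M -> tends_mx B 1%:M -> tends_mx B' 1%:M ->
  rapid_mx (fun n => B n - A n) -> rapid_mx (fun n => A' n - B' n) ->
  rapid_mx (fun n => invmx (A n) *m A' n - invmx (B n) *m B' n).
Proof.
move=> a b b' ab ab'; have [n0 H0] := tends_unitmx a; have [n1 H1] := tends_unitmx b.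
have h1 := rapid_mulmxr (tends_invmx a) ab'.
have h2 := rapid_mulmxl (rapid_mulmxl (rapid_mulmxr (tends_invmx a) ab)
  (tends_invmx b)) b'.
move=> i j; have := rapidD (h1 i j) (h2 i j).
apply: (@rapid_evt _ _ _ (maxn n0 n1)) => n; rewrite geq_max => /andP[/H0 {}H0 /H1 {}H1].
have -> : invmx (A n) *m A' n - invmx (B n) *m B' n =
  invmx (A n) *m (A' n - B' n) + invmx (A n) *m (B n - A n) *m invmx (B n) *m B' n.
  rewrite !mulmxBr mulVmx // !mulmxBl mul1mx -!mulmxA mulKVmx //.
  by rewrite addrA subrK.
by rewrite [in RHS]mxE.
Qed.

End MatrixSequences.

(** * The linear system and its blocks *)

Section System.
Variable RR : realType.
Local Notation C := RR[i].
Variables (N : nat) (fl : 'I_N -> 'I_N) (U : 'I_N -> C) (c : C).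
Local Notation M := 'M[C]_N.

(** Puts a row of the system in the form required by Gronwall. If k = k' the two contributions add
    up, so fixed points of the flip need no separate treatment. *)
Lemma sum_delta2 (k k' : 'I_N) (d p q : C) (F : 'I_N -> C) :
  \sum_l d * (p *+ (l == k) + q *+ (l == k')) * F l = d * (p * F k + q * F k').
Proof.
have E (a : C) j : \sum_l d * (a *+ (l == j)) * F l = d * (a * F j).
  rewrite (bigD1 j) //= eqxx mulr1n big1 ?addr0 ?mulrA // => l /negPf ->.
  by rewrite mulr0n mulr0 mul0r.
rewrite mulrDr -!E -big_split /=; apply: eq_bigr => l _.
by rewrite mulrDr mulrDl.
Qed.

Lemma cabs_Mb (x : C) (b : bool) : cabs (x *+ b) <= cabs x.
Proof. by case: b; rewrite ?mulr1n // mulr0n cabs0 cabs_ge0. Qed.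

(* The equation with U = u1 / kappa, c = 1 / kappa and Omega the permutation *)
(* matrix of fl.                                                             *)
Definition msol (D : set C) (Y : C -> M) := forall z, D z -> forall i j,
  cderiv_at (fun z => Y z i j) z (U i * Y z i j + c / z * Y z (fl i) j).

(** The right, left and upper half planes are the cases w = 1, -1 and - i; each is convex and avoids
    0, which is all that uniqueness of solutions needs. *)
Definition hp (w : C) : set C := [set z | 0 < complex.Re (w * z)].

Lemma hp_imag (z : C) : hp (- 'i) z = (0 < complex.Im z) :> Prop.
Proof. by rewrite /hp /= !ReImE /= oppr0 mul0r mulN1r opprK add0r. Qed.
Lemma hp1 (z : C) : hp 1 z = (0 < complex.Re z) :> Prop.
Proof. by rewrite /hp /= mul1r. Qed.
Lemma hpN1 (z : C) : hp (-1) z = (complex.Re z < 0) :> Prop.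
Proof. by rewrite /hp /= mulN1r cReN oppr_gt0. Qed.

Lemma msol_mulmx D Y (B : M) : msol D Y -> msol D (fun z => Y z *m B).
Proof.
move=> h z Dz i j; have := cderiv_at_sum (fun k => cderiv_atZ (B k j) (h z Dz i k)).
move=> H; apply: cderiv_at_eq (cderiv_at_ext _ H) _.
  by move=> x; rewrite mxE; apply: eq_bigr => k _; rewrite mulrC.
rewrite !mxE !mulr_sumr -big_split /=; apply: eq_bigr => k _; ring.
Qed.

Lemma msol_sub D Y Y' : msol D Y -> msol D Y' -> msol D (fun z => Y z - Y' z).
Proof.
move=> h h' z Dz i j; have := cderiv_atD (h z Dz i j) (cderiv_atZ (-1) (h' z Dz i j)).
move=> H; apply: cderiv_at_eq (cderiv_at_ext _ H) _.
  by move=> x; rewrite !mxE mulN1r.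
by rewrite !mxE; ring.
Qed.

(** Gronwall along the segment from z0 to z1, for each column of Y. *)
Lemma msol_uniq w Y z0 z1 : msol (hp w) Y -> hp w z0 -> hp w z1 -> Y z0 = 0 -> Y z1 = 0.
Proof.
move=> sY h0 h1 Y0; apply/matrixP => i j; rewrite mxE.
pose g (t : RR) : C := z0 + t%:C * (z1 - z0).
have dg t : is_cderive g t (z1 - z0).
  apply: is_cderive_eq (is_cderiveD (is_cderive_cst z0 t)
    (is_cderiveM (is_cderive_real t) (is_cderive_cst (z1 - z0) t))) _.
  by rewrite mulr0 addr0 add0r mul1r.
(* By convexity [mu] bounds Re (w z) from below on the segment, which keeps it away from the
   singularity at 0. *)
set mu := Order.min (complex.Re (w * z0)) (complex.Re (w * z1)).
have mu0 : 0 < mu by rewrite lt_min; apply/andP.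
have gmu (t : RR) : 0 <= t <= 1 -> mu <= complex.Re (w * g t).
  move=> /andP[t0 t1].
  have -> : complex.Re (w * g t) = (1 - t) * complex.Re (w * z0)
    + t * complex.Re (w * z1).
    by rewrite /g !ReImE /=; ring.
  have m0 : mu <= complex.Re (w * z0) by rewrite ge_min lexx.
  have m1 : mu <= complex.Re (w * z1) by rewrite ge_min lexx orbT.
  nra.
pose a (t : RR) (k l : 'I_N) : C := (z1 - z0) * (U k *+ (l == k)
  + c / g t *+ (l == fl k)).
pose eps := cabs (z1 - z0) * (\sum_k cabs (U k) + cabs c * (cabs w / mu)).
have w0 : 0 < cabs w.
  by rewrite cabs_gt0; apply: contraTneq h0 => ->; rewrite /hp /= mul0r ltxx.
have df (t : RR) k : 0 <= t <= 1 ->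
    is_cderive (fun t => Y (g t) k j) t (\sum_l a t k l * Y (g t) l j).
  move=> t01; rewrite sum_delta2.
  have hg : hp w (g t) by apply: lt_le_trans mu0 (gmu _ t01).
  exact: (sY _ hg k j g t).
have a_le (t : RR) k l : 0 <= t <= 1 -> cabs (a t k l) <= eps.
  move=> t01; rewrite /a cabsM ler_wpM2l ?cabs_ge0 // (le_trans (cabsD _ _)) //.
  apply: lerD; apply: le_trans (cabs_Mb _ _) _.
    by rewrite (bigD1 k) //= lerDl sumr_ge0 // => *; rewrite cabs_ge0.
  rewrite cabsM cabsV ler_wpM2l ?cabs_ge0 //.
  have := le_trans (gmu _ t01) (le_trans (ler_norm _) (Re_le_cabs _)).
  rewrite cabsM => H; have g0 : 0 < cabs (g t).
    by rewrite -(pmulr_rgt0 _ w0) (lt_le_trans mu0 H).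
  by rewrite ler_pdivlMr // ler_pdivrMl // mulrC.
have t01 : 0 <= (1 : RR) <= 1 by rewrite ler01 lexx.
have z01 : g 1 = z1 by rewrite /g mul1r addrC subrK.
have := gronwall (f := fun k t => Y (g t) k j) df a_le t01.
rewrite [X in _ <= _ * X]big1 => [|k _]; last first.
  by rewrite /g mul0r addr0 Y0 mxE cabs0 expr0n.
rewrite mulr0 z01 => H; apply/eqP; rewrite -cabs_eq0 -sqrf_eq0; apply/eqP.
apply: le_anti; rewrite sqr_ge0 andbT; apply: le_trans H.
by rewrite (bigD1 i) //= lerDl sumr_ge0 // => *; rewrite sqr_ge0.
Qed.

(** The columns of [cokermx (Y z1)] span the right kernel of [Y z1]. Multiplying Y by them gives a
    solution vanishing at z1, hence at z0, where Y is invertible. *)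
Lemma msol_unit w Y z0 z1 : msol (hp w) Y -> hp w z0 -> hp w z1 ->
  Y z0 \in unitmx -> Y z1 \in unitmx.
Proof.
move=> sY h0 h1 u0; rewrite -row_full_unit -cokermx_eq0; apply/eqP.
have := @msol_uniq w (fun z => Y z *m cokermx (Y z1)) z1 z0.
move=> /(_ (msol_mulmx _ sY) h1 h0 (mulmx_coker _)) /(congr1 (mulmx (invmx (Y z0)))).
by rewrite mulKmx // mulmx0.
Qed.

Lemma msol_eq w Y Y' z0 z1 : msol (hp w) Y -> msol (hp w) Y' -> hp w z0 -> hp w z1 ->
  Y z0 = Y' z0 -> Y z1 = Y' z1.
Proof.
move=> sY sY' h0 h1 e; apply/eqP; rewrite -subr_eq0; apply/eqP.
apply: (msol_uniq (msol_sub sY sY') h0 h1); apply/eqP; by rewrite subr_eq0 e.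
Qed.

Lemma cderiv_at_local (D : set C) F G z d : (forall g t e, g t = z -> is_cderive g t e ->
    \forall x \near t, D (g x)) -> (forall z, D z -> F z = G z) ->
  cderiv_at F z d -> cderiv_at G z d.
Proof.
move=> Dn FG h g t e gt dg; apply: is_cderive_near (h g t e gt dg).
by near=> x; apply: FG; near: x; exact: Dn gt dg.
Unshelve. all: by end_near. Qed.

Lemma near_quadrant (g : RR -> C) t e : complex.Re (g t) < 0 -> 0 < complex.Im (g t) ->
  is_cderive g t e -> \forall x \near t, complex.Re (g x) < 0 /\ 0 < complex.Im (g x).
Proof.
move=> r0 i0 [dr di].
have cr := is_derive_cts dr; have ci := is_derive_cts di.
have h1 : \forall x \near t, complex.Re (g x) < 0.
  by apply: (cr [set v | v < 0]); apply: lt_nbhsl.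
have h2 : \forall x \near t, 0 < complex.Im (g x).
  by apply: (ci [set v | 0 < v]); apply: lt_nbhsr.
by near=> x; split; near: x.
Unshelve. all: by end_near. Qed.

Lemma is_derive_uniq (f : RR -> RR) (t d e : RR)
  : is_derive t 1 f d -> is_derive t 1 f e -> d = e.
Proof. by case=> _ <- [_ <-]. Qed.

(* On the imaginary axis the derivative is the limit of the derivatives at    *)
(* nearby points.                                                             *)
Lemma msol_upper Y : msol (hp 1) Y ->
  (forall z, complex.Re z < 0 -> 0 < complex.Im z -> forall i j,
     cderiv_at (fun z => Y z i j) z (U i * Y z i j + c / z * Y z (fl i) j)) ->
  (forall z, 0 < complex.Im z -> forall i j, exists d, cderiv_at (fun z => Y z i j)
    z d) ->
  msol (hp (- 'i)) Y.
Proof.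
move=> sR sL dY z; rewrite /hp /= !ReImE /= oppr0 mul0r mulN1r opprK add0r => z0 i j.
have [zr|zr|zr] := ltgtP (complex.Re z) 0.
- exact: sL.
- by apply: sR; rewrite /hp /= mul1r.
have [d hd] := dY z z0 i j; suff -> : U i * Y z i j + c / z * Y z (fl i) j = d by [].
pose g (t : RR) : C := z + t%:C.
have dg t : is_cderive g t 1.
  by apply: is_cderive_eq (is_cderiveD (is_cderive_cst z t) (is_cderive_real t)) _;
    rewrite add0r.
have Ig t : complex.Im (g t) = complex.Im z by rewrite /g !ReImE /= addr0.
have Rg t : complex.Re (g t) = t by rewrite /g !ReImE /= zr add0r.
have gn0 t : g t != 0.
  by apply: contraTneq z0 => h; rewrite -(Ig t) h ltxx.
have g0 : g 0 = z by rewrite /g addr0.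
pose F (t : RR) := Y (g t) i j.
pose G (t : RR) := U i * Y (g t) i j + c * (g t)^-1 * Y (g t) (fl i) j.
have dF (t : RR) k l : exists e, is_cderive (fun t => Y (g t) k l) t e.
  have [e he] : exists e, cderiv_at (fun z => Y z k l) (g t) e.
    by apply: dY; rewrite Ig.
  by exists (1 * e); apply: (he g t).
have dFG (t : RR) : t != 0 -> is_cderive F t (G t).
  move=> t0; rewrite -[G t]mul1r.
  have [tn|tp] : t < 0 \/ 0 < t by case: (ltgtP t 0) t0 => // h _; [left|right].
    by apply: (sL (g t) _ _ i j g t) => //; rewrite ?Rg ?Ig.
  by apply: (sR (g t) _ i j g t) => //; rewrite /hp /= mul1r Rg.
have [e1 h1] := dF 0 i j; have [e2 h2] := dF 0 (fl i) j.
have hV := is_cderiveV (gn0 0) (dg 0).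
have [Gr Gi] := is_cderiveD (is_cderiveZ (U i) h1) (is_cderiveM (is_cderiveZ c hV) h2).
have [Fr Fi] := h1.
have [Dr Di] : is_cderive F 0 d by rewrite -[d]mul1r; apply: (hd g 0).
have Hr : complex.Re (G 0) = complex.Re d.
  apply: is_derive_uniq Dr.
  apply: (is_derive_removable (g := fun t => complex.Re (G t))).
  - by move=> x /dFG[].
  - exact: is_derive_cts Fr.
  - exact: is_derive_cts Gr.
have Hi : complex.Im (G 0) = complex.Im d.
  apply: is_derive_uniq Di.
  apply: (is_derive_removable (g := fun t => complex.Im (G t))).
  - by move=> x /dFG[].
  - exact: is_derive_cts Fi.
  - exact: is_derive_cts Gi.
by rewrite -(complex_ext Hr Hi) /G g0.
Qed.

(** * Block structure given by the orbits of the flip *)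

Definition blk (i j : 'I_N) := (j == i) || (j == fl i).
Definition blockmx (A : M) := forall i j, ~~ blk i j -> A i j = 0.
Definition blockpart (A : M) : M := \matrix_(i, j) (A i j *+ blk i j).

Hypothesis flK : involutive fl.

Lemma blk_refl i : blk i i. Proof. by rewrite /blk eqxx. Qed.
Lemma blk_fl i : blk i (fl i). Proof. by rewrite /blk eqxx orbT. Qed.
Lemma blk_sym i j : blk i j = blk j i.
Proof. by rewrite /blk eq_sym; congr orb; apply/eqP/eqP => ->; rewrite flK. Qed.
Lemma blk_fll i j : blk (fl i) j = blk i j.
Proof. by rewrite /blk flK orbC. Qed.
Lemma blk_flr i j : blk i (fl j) = blk i j.
Proof. by rewrite blk_sym blk_fll blk_sym. Qed.
Lemma blk_trans i j k : blk i j -> blk i k = blk j k.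
Proof. by case/orP => /eqP ->; rewrite ?blk_fll. Qed.

Lemma blockpartP A : blockmx (blockpart A).
Proof. by move=> i j /negPf h; rewrite mxE h mulr0n. Qed.
Lemma blockpart_id A : blockmx A -> blockpart A = A.
Proof.
move=> h; apply/matrixP => i j; rewrite mxE; case: (boolP (blk i j)) => // /h ->.
by rewrite mulr0n.
Qed.

Lemma blockpartMl A X : blockmx A -> A *m blockpart X = blockpart (A *m X).
Proof.
move=> a; apply/matrixP => i j; rewrite !mxE -sumrMnl; apply: eq_bigr => k _.
rewrite mxE; case: (boolP (blk i k)) => [ik|/a ->]; last by rewrite !mul0r mul0rn.
by rewrite (blk_trans _ ik) mulrnAr.
Qed.

(** Taking block parts commutes with left multiplication by A, so X and its block part have the same
    image under A. *)
Lemma blockmx_cancel A X : blockmx A -> A \in unitmx -> blockmx (A *m X) -> blockmx X.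
Proof.
move=> a u ax; suff <- : blockpart X = X by exact: blockpartP.
by rewrite -[LHS](mulKmx u) blockpartMl // blockpart_id // mulKmx.
Qed.

(** The equation couples only the rows i and [fl i], and the mask [blk i j] takes the same value on
    both. *)
Lemma msol_blockpart D Y : msol D Y -> msol D (fun z => blockpart (Y z)).
Proof.
move=> h z Dz i j; rewrite !mxE blk_fll; case: (boolP (blk i j)) => ij.
  rewrite !mulr1n; apply: (cderiv_at_ext _ (h z Dz i j)) => x.
  by rewrite mxE ij mulr1n.
rewrite !mulr0n !mulr0 addr0; have H : cderiv_at (fun=> 0) z 0 := @cderiv_at_cst RR 0 z.
by apply: cderiv_at_ext H => x; rewrite mxE (negPf ij).
Qed.

Lemma blockmx_comm_diag A (f : 'I_N -> C) : (forall i j, blk i j -> f i = f j) ->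
  blockmx A -> diag_mx (\row_i f i) *m A = A *m diag_mx (\row_i f i).
Proof.
move=> hf a; apply/matrixP => i j; rewrite mul_diag_mx mul_mx_diag !mxE.
case: (boolP (blk i j)) => [/hf ->|/a ->]; first by rewrite mulrC.
by rewrite mulr0 mul0r.
Qed.

(** The projection onto a block commutes with Y, so the partial trace is invariant under conjugation
    by Y. *)
Lemma block_trace Y A i : blockmx Y -> Y \in unitmx ->
  \sum_(k | blk i k) (Y *m A *m invmx Y) k k = \sum_(k | blk i k) A k k.
Proof.
move=> bY uY; pose P : M := diag_mx (\row_k (blk i k)%:R).
have trP (B : M) : \sum_(k | blk i k) B k k = \tr (P *m B).
  rewrite /mxtrace big_mkcond; apply: eq_bigr => k _.
  by rewrite mul_diag_mx !mxE; case: blk; rewrite ?mul1r ?mul0r.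
rewrite !trP -!mulmxA mulmxA blockmx_comm_diag // => [|k l kl].
  by rewrite -mulmxA mxtrace_mulC -!mulmxA mulVmx // mulmx1.
by rewrite blk_sym [blk i l]blk_sym (blk_trans _ kl).
Qed.

End System.

(** * Solutions on small arcs around 0 *)

Section Arc.
Variable RR : realType.
Local Notation C := RR[i].
Variables (N : nat) (fl : 'I_N -> 'I_N) (U : 'I_N -> C) (c : C).
Hypothesis flK : involutive fl.
Local Notation M := 'M[C]_N.
Local Notation half_turn := (0 +i* pi : C).
Let q : C := half_turn * c.

(** Hyperbolic cosine and, below, sine. As the flip P satisfies P^2 = 1, e^(x P) is [cch x] +
    [csh x] P. *)
Definition cch (x : C) : C := 2^-1 * (cexp x + cexp (- x)).
Definition csh (x : C) : C := 2^-1 * (cexp x - cexp (- x)).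


Lemma cch_sqr x : cch x * cch x = 1 + csh x * csh x.
Proof.
rewrite /cch /csh cexpN; have := cexp_neq0 x; move: (cexp x) => y y0.
by field; rewrite y0.
Qed.

Lemma cch0 : cch 0 = 1.
Proof. by rewrite /cch oppr0 cexp0; field. Qed.
Lemma csh0 : csh 0 = 0.
Proof. by rewrite /csh oppr0 subrr mulr0. Qed.

Lemma is_cderive_cch t : is_cderive (fun s : RR => cch (s%:C * q)) t (q * csh (t%:C * q)).
Proof.
have d1 : is_cderive (fun s : RR => s%:C * q) t q.
  apply: is_cderive_eq (is_cderiveM (is_cderive_real t) (is_cderive_cst q t)) _.
  by rewrite mul1r mulr0 addr0.
have := is_cderiveZ 2^-1 (is_cderiveD (is_cderive_cexp d1)
  (is_cderive_cexp (is_cderiveN d1))).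
by move=> h; apply: is_cderive_eq h _; rewrite /csh; ring.
Qed.

Lemma is_cderive_csh t : is_cderive (fun s : RR => csh (s%:C * q)) t (q * cch (t%:C * q)).
Proof.
have d1 : is_cderive (fun s : RR => s%:C * q) t q.
  apply: is_cderive_eq (is_cderiveM (is_cderive_real t) (is_cderive_cst q t)) _.
  by rewrite mul1r mulr0 addr0.
have := is_cderiveZ 2^-1 (is_cderiveD (is_cderive_cexp d1)
  (is_cderiveN (is_cderive_cexp (is_cderiveN d1)))).
by move=> h; apply: is_cderive_eq h _; rewrite /cch; ring.
Qed.

Let K0 := expR (cabs q).
Let cexp_le (t : RR) (s : C) : 0 <= t <= 1 -> cabs s = 1 -> cabs (cexp (s * (t%:C *
  q))) <= K0.
Proof.
move=> /andP[t0 t1] s1; rewrite cabs_cexp ler_expR; apply: le_trans (ler_norm _) _.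
apply: le_trans (Re_le_cabs _) _; rewrite !cabsM s1 mul1r cabs_real ger0_norm //.
by rewrite -[leRHS]mul1r ler_wpM2r ?mulr_ge0 ?cabs_ge0.
Qed.

Let half_sum_le x y : cabs x <= K0 -> cabs y <= K0 -> cabs (2^-1 * (x + y)) <= K0.
Proof.
move=> hx hy; rewrite cabsM cabsV cabs_nat ler_pdivrMl //.
by rewrite (le_trans (cabsD _ _)) // mulr_natl mulr2n lerD //.
Qed.

Let cch_le (t : RR) : 0 <= t <= 1 -> cabs (cch (t%:C * q)) <= K0.
Proof.
move=> t01; have h1 := cexp_le t01 (cabs1 _).
have h2 : cabs (cexp (-1 * (t%:C * q))) <= K0 by apply: cexp_le; rewrite ?cabsN ?cabs1.
by apply: half_sum_le; [rewrite mul1r in h1|rewrite mulN1r in h2].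
Qed.

Let csh_le (t : RR) : 0 <= t <= 1 -> cabs (csh (t%:C * q)) <= K0.
Proof.
move=> t01; have h1 := cexp_le t01 (cabs1 _).
have h2 : cabs (cexp (-1 * (t%:C * q))) <= K0 by apply: cexp_le; rewrite ?cabsN ?cabs1.
by apply: half_sum_le; [rewrite mul1r in h1|rewrite mulN1r in h2; rewrite cabsN].
Qed.

Variable Y : C -> M.
Hypothesis sol1 : msol fl U c (hp 1) Y.
Hypothesis soli : msol fl U c (hp (- 'i)) Y.
Hypothesis unitY : forall z, hp 1 z -> Y z \in unitmx.

(** Starting at argument - pi / 4, the half-circle ends at 3 pi / 4, in the second quadrant where
    the Stokes relation is available. *)
Let base : C := 1 -i* 1.
Let KU := cabs half_turn * cabs base * (4 * (K0 * K0 * \sum_k cabs (U k))).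

Let KU_ge0 : 0 <= KU.
Proof.
by rewrite /KU !mulr_ge0 ?cabs_ge0 ?expR_ge0 //; apply: sumr_ge0 => k _; rewrite cabs_ge0.
Qed.

Section FixedRadius.
Variable r : RR.
Hypothesis r0 : 0 < r.
Let z0 : C := r%:C * base.
Let g (t : RR) : C := z0 * cexp (t%:C * half_turn).

Let g0 : g 0 = z0. Proof. by rewrite /g mul0r cexp0 mulr1. Qed.
Let g1 : g 1 = - z0. Proof. by rewrite /g mul1r cexp_pi mulrN1. Qed.
Let cabs_turn (t : RR) : cabs (cexp (t%:C * half_turn)) = 1.
Proof. by rewrite cabs_cexp cReM /= mulr0 mul0r subr0 expR0. Qed.

Let z0_in : hp 1 z0.
Proof.
suff h : complex.Re (1 * z0) = r by change (is_true (0 < complex.Re (1 * z0))); rewrite h.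
by rewrite /z0 !ReImE /=; ring.
Qed.

(** Up to the factor r, real and imaginary parts are cos + sin and sin - cos. With sin >= 0, if the
    first is not positive then the second is. *)
Let g_in (t : RR) : 0 <= t <= 1 -> hp 1 (g t) \/ hp (- 'i) (g t).
Proof.
move=> /andP[t0 t1]; have s0 : 0 <= sin (t * pi : RR).
  by apply: sin_ge0_pi; rewrite mulr_ge0 ?pi_ge0 //= -[leRHS]mul1r ler_wpM2r ?pi_ge0.
have sq : cos (t * pi) ^+ 2 + sin (t * pi) ^+ 2 = 1 :> RR := cos2Dsin2 _.
have gR : complex.Re (1 * g t) = r * (cos (t * pi) + sin (t * pi)).
  rewrite /g /cexp !ReImE /= !(mulr0, mul0r, subr0, addr0, oppr0, expR0, add0r); ring.
have gI : complex.Re (- 'i * g t) = r * (sin (t * pi) - cos (t * pi)).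
  rewrite /g /cexp !ReImE /= !(mulr0, mul0r, subr0, addr0, oppr0, expR0, add0r); ring.
change (is_true (0 < complex.Re (1 * g t)) \/ is_true (0 < complex.Re (- 'i * g t))).
rewrite gR gI !pmulr_rgt0 //.
move: (cos (t * pi)) (sin (t * pi)) s0 sq => x y y0 xy.
have [h|h] := ltP 0 (x + y); first by left.
by right; nra.
Qed.

Let dg t : is_cderive g t (half_turn * g t).
Proof.
have d1 : is_cderive (fun s : RR => s%:C * half_turn) t half_turn.
  apply: is_cderive_eq (is_cderiveM (is_cderive_real t) (is_cderive_cst half_turn t)) _.
  by rewrite mul1r mulr0 addr0.
apply: is_cderive_eq (is_cderiveZ z0 (is_cderive_cexp d1)) _; rewrite /g; ring.
Qed.

Let gn0 t : g t != 0.
Proof.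
by rewrite mulf_neq0 ?cexp_neq0 //; move: z0_in; rewrite hp1; apply: contraTneq => ->;
  rewrite ltxx.
Qed.

Variable j : 'I_N.
Let Z (k : 'I_N) (t : RR) : C := (Y (g t) *m invmx (Y z0)) k j.

(** Since dz = i pi z dt on the arc, the singular term c / z turns into the constant q, while the
    regular term acquires the factor [g t], of size r. *)
Let dZ (t : RR) k : 0 <= t <= 1 ->
  is_cderive (Z k) t (half_turn * g t * U k * Z k t + q * Z (fl k) t).
Proof.
move=> t01; have H : cderiv_at (fun z => (Y z *m invmx (Y z0)) k j) (g t)
    (U k * Z k t + c / g t * Z (fl k) t).
  by case: (g_in t01) => h; [exact: (msol_mulmx _ sol1)|exact: (msol_mulmx _ soli)].
apply: is_cderive_eq (H g t _ erefl (dg t)) _.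
by rewrite /q; field; exact: gn0.
Qed.

(* f = e^(- t q P) Z, with P the permutation matrix of fl. *)
Let f (k : 'I_N) (t : RR) : C := cch (t%:C * q) * Z k t - csh (t%:C * q) * Z (fl k) t.
(** Coefficients of e^(- t q P) (i pi g U) e^(t q P): the conjugation absorbs the term q P and
    leaves only entries of order r. *)
Let a (t : RR) (k l : 'I_N) : C := half_turn * g t *
  ((cch (t%:C * q) * cch (t%:C * q) * U k - csh (t%:C * q) * csh (t%:C * q) * U (fl k))
    *+ (l == k)
   + (cch (t%:C * q) * csh (t%:C * q) * (U k - U (fl k))) *+ (l == fl k)).

Let df (t : RR) k : 0 <= t <= 1 -> is_cderive (f k) t (\sum_l a t k l * f l t).
Proof.
move=> t01; rewrite sum_delta2.
have := is_cderiveD (is_cderiveM (is_cderive_cch t) (dZ k t01))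
   (is_cderiveN (is_cderiveM (is_cderive_csh t) (dZ (fl k) t01))).
move=> h; apply: is_cderive_eq h _; rewrite /f flK.
have E := cch_sqr (t%:C * q).
move: (cch _) (csh _) (Z k t) (Z (fl k) t) (g t) (U k) (U (fl k)) (half_turn) E.
move=> x y zk zf gt uk uf h E.
rewrite [RHS](_ : _ = h * gt * (x * (x * x - y * y) * uk * zk - y * (x * x - y * y)
  * uf * zf)); last by ring.
by rewrite E addrK; ring.
Qed.

Let a_le (t : RR) k l : 0 <= t <= 1 -> cabs (a t k l) <= r * KU.
Proof.
move=> t01; rewrite /a cabsM cabsM /g cabsM cabs_turn mulr1 /z0 cabsM cabs_real
  gtr0_norm //.
rewrite [leRHS](_ : _ = cabs half_turn * (r * cabs base)
  * (4 * (K0 * K0 * \sum_k cabs (U k)))); last by rewrite /KU; ring.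
rewrite ler_wpM2l ?mulr_ge0 ?cabs_ge0 ?(ltW r0) //.
have h1 := cch_le t01; have h2 := csh_le t01.
have p2 x y : cabs x <= K0 -> cabs y <= K0 -> cabs (x * y) <= K0 * K0.
  by move=> hx hy; rewrite cabsM ler_pM ?cabs_ge0.
have u1 i : cabs (U i) <= \sum_k cabs (U k).
  by rewrite (bigD1 i) //= lerDl sumr_ge0 // => *; rewrite cabs_ge0.
set su := \sum_k _ in u1 *.
have p3 x y i : cabs x <= K0 -> cabs y <= K0 -> cabs (x * y * U i) <= K0 * K0 * su.
  by move=> hx hy; rewrite cabsM ler_pM ?cabs_ge0 ?p2.
rewrite [leRHS](_ : _ = (K0 * K0 * su + K0 * K0 * su) + (K0 * K0 * su + K0 * K0 * su));
  last by ring.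
apply: le_trans (cabsD _ _) _; apply: lerD; apply: le_trans (cabs_Mb _ _) _.
  by apply: le_trans (cabsD _ _) _; rewrite cabsN; apply: lerD; apply: p3.
rewrite mulrBr; apply: le_trans (cabsD _ _) _; rewrite cabsN; apply: lerD; exact: p3.
Qed.

(** At t = 0 the column f is the j-th basis vector, so its squared norm is 1; at t = 1 it is e^(- q
    P) applied to the j-th column of the transport from z0 to - z0. *)
Lemma arc_estimate k :
  cabs (cch q * (Y (- z0) *m invmx (Y z0)) k j - csh q * (Y (- z0) *m invmx (Y z0))
    (fl k) j
    - (k == j)%:R)
  <= 2 * (r * KU) * N%:R * (1 + expR (2 * (r * KU) * N%:R)).
Proof.
have Z0 l : Z l 0 = (l == j)%:R by rewrite /Z g0 mulmxV ?unitY // mxE.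
have F0 l : f l 0 = (l == j)%:R by rewrite /f mul0r cch0 csh0 mul1r mul0r subr0 Z0.
have := gronwall_diff (f := f) df a_le k (mulr_ge0 (ltW r0) KU_ge0).
rewrite F0 {1}/f /Z g1 !mul1r.
rewrite (bigD1 j) //= F0 eqxx cabs1 expr1n big1 ?addr0 ?mulr1 //.
by move=> i /negPf ij; rewrite F0 ij cabs0 expr0n.
Qed.

End FixedRadius.

Definition arc_point (n : nat) : C := (n.+1%:R^-1)%:C * base.

(* The limit is the entry of e^(q P) = cch q + csh q P. *)
Lemma arc_limit k j :
  tends (fun n => (Y (- arc_point n) *m invmx (Y (arc_point n))) k j)
        (cch q * (k == j)%:R + csh q * (fl k == j)%:R).
Proof.
pose V n := Y (- arc_point n) *m invmx (Y (arc_point n)).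
have est l : tends (fun n => cch q * V n l j - csh q * V n (fl l) j) (l == j)%:R.
  exists (2 * KU * N%:R * (1 + expR (2 * KU * N%:R))); exists 0%N => n _; rewrite expr1.
  have r0 : 0 < n.+1%:R^-1 :> RR by rewrite invr_gt0 ltr0n.
  have r1 : n.+1%:R^-1 <= 1 :> RR by rewrite invf_le1 ?ltr0n // ler1n.
  apply: le_trans (ler_wpM2r (ler0n _ _) (arc_estimate r0 j l)) _.
  set r := n.+1%:R^-1 in r0 r1 *.
  have rn : r * n%:R <= 1 by rewrite /r ler_pdivrMl ?ltr0n // mulr1 ler_nat.
  set E := expR (2 * KU * N%:R).
  have hE : expR (2 * (r * KU) * N%:R) <= E.
    rewrite ler_expR ler_wpM2r // ler_wpM2l // -[leRHS]mul1r ler_wpM2r //.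
  rewrite [leLHS](_ : _ = (2 * KU * N%:R) * ((r * n%:R) * (1 + expR (2 * (r * KU)
    * N%:R)))); last by ring.
  apply: ler_wpM2l; first exact: (mulr_ge0 (mulr_ge0 (ler0n _ 2) KU_ge0) (ler0n _ _)).
  rewrite -[leRHS]mul1r; apply: ler_pM => //.
  - by rewrite mulr_ge0 // ltW.
  - exact: lerD.
(* Applying e^(q P) undoes e^(- q P), because [cch q] and [csh q] have squares differing by 1. *)
have := tendsD (tendsM (tends_cst (cch q)) (est k)) (tendsM (tends_cst (csh q))
  (est (fl k))).
apply: seqO_ext => n; congr (_ - _); rewrite flK -/(V n).
rewrite [LHS](_ : _ = (cch q * cch q - csh q * csh q) * V n k j); last by ring.
by rewrite cch_sqr addrK mul1r.
Qed.

(** Disposes of the scalar factor of the flip symmetry as z tends to 0. *)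
Lemma tends_cexp_arc_point (b : C) : tends (fun n => cexp (arc_point n * b)) 1.
Proof.
pose d := base * b.
have d1 : is_cderive (fun s : RR => s%:C * d) 0 d.
  apply: is_cderive_eq (is_cderiveM (is_cderive_real 0) (is_cderive_cst d 0)) _.
  by rewrite mul1r mulr0 addr0.
have := is_cderive_cexp d1; rewrite mul0r cexp0 mulr1 => /is_cderive_epsP /(_ 1
  ltr01)[r r0 H].
exists (1 + cabs d); exists (Num.bound `|r^-1|) => n nn; rewrite expr1.
have nr : (n.+1%:R)^-1 < r.
  rewrite -[ltRHS]invrK ltf_pV2 ?posrE ?invr_gt0 ?ltr0n //.
  by apply: lt_le_trans (ltr_archi _) _; rewrite ler_nat leqW.
have n0 : 0 < n.+1%:R^-1 :> RR by rewrite invr_gt0 ltr0n.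
have := H (n.+1%:R^-1); rewrite gtr0_norm // => /(_ nr).
rewrite add0r !mul0r cexp0 mul1r -/(arc_point n) => {}H.
have E : (n.+1%:R^-1)%:C * d = arc_point n * b by rewrite /d mulrA.
rewrite E in H.
have h : cabs (cexp (arc_point n * b) - 1) <= n.+1%:R^-1 * (1 + cabs d).
  rewrite -[X in cabs X](subrK (arc_point n * b)); apply: le_trans (cabsD _ _) _.
  rewrite mulrDr mulr1; apply: lerD => //.
  by rewrite -E cabsM cabs_real gtr0_norm.
apply: le_trans (ler_wpM2r (ler0n _ _) h) _; rewrite mulrAC -[leRHS]mul1r ler_wpM2r //.
  by rewrite addr_ge0 ?cabs_ge0.
by rewrite ler_pdivrMl ?ltr0n // mulr1 ler_nat.
Qed.

Lemma hp_arc_point n : hp 1 (arc_point n).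
Proof.
have n0 : 0 < n.+1%:R^-1 :> RR by rewrite invr_gt0 ltr0n.
suff h : complex.Re (1 * arc_point n) = n.+1%:R^-1.
  by change (is_true (0 < complex.Re (1 * arc_point n))); rewrite h.
by rewrite /arc_point !ReImE /=; ring.
Qed.

Lemma hp_arc_pointN n : complex.Re (- arc_point n) < 0 /\ 0 < complex.Im (- arc_point n).
Proof.
have n0 : 0 < n.+1%:R^-1 :> RR by rewrite invr_gt0 ltr0n.
suff [-> ->] : complex.Re (- arc_point n) = - n.+1%:R^-1 /\ complex.Im (- arc_point n)
  = n.+1%:R^-1.
  by rewrite oppr_lt0.
by rewrite /arc_point !ReImE /=; split; ring.
Qed.

End Arc.

(** * Stokes matrix *)

Section Canonical.
Variable RR : realType.
Local Notation C := RR[i].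
Variables (N : nat) (fl : 'I_N -> 'I_N) (alpha : 'I_N -> RR) (c : C).
Local Notation M := 'M[C]_N.
(** The tensor product is abstracted to an involution and exponents [alpha], which separate the two
    elements of an orbit and the fixed points from each other. Distinct orbits may still contain
    equal exponents. *)
Hypothesis flK : involutive fl.
Hypothesis alpha_fl : forall i, fl i != i -> alpha i != alpha (fl i).
Hypothesis alpha_fix :
  forall i j, fl i = i -> fl j = j -> alpha i = alpha j -> i = j.

Let U (i : 'I_N) : C := 0 +i* alpha i.
Local Notation blk := (blk fl).
Local Notation blockmx := (blockmx fl).
Local Notation blockpart := (blockpart fl).
Local Notation msol := (msol fl U c).

Definition omega (i : 'I_N) : bool := fl i == i.

(* The j-th diagonal entry of e^(z u1 / kappa) z^([Omega] / kappa). *)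
Definition expo (b : bool) (z : C) (j : 'I_N) : C :=
  cexp (z * U j + blog b z * (c * (omega j)%:R)).

Definition with_expo b (H : C -> M) (z : C) : M := \matrix_(i, j) (H z i j * expo b z j).

Lemma expo_neq0 b z j : expo b z j != 0. Proof. exact: cexp_neq0. Qed.

Lemma with_expoE b H z : with_expo b H z = H z *m diag_mx (\row_j expo b z j).
Proof. by apply/matrixP => i j; rewrite mul_mx_diag !mxE. Qed.

Lemma unit_diag_expo b z : diag_mx (\row_j expo b z j) \in unitmx.
Proof.
rewrite unitmxE det_diag unitfE; apply/prodf_neq0 => j _; rewrite mxE; exact: expo_neq0.
Qed.

Lemma with_expo_unit b H z : (with_expo b H z \in unitmx) = (H z \in unitmx).
Proof. by rewrite with_expoE unitmx_mul unit_diag_expo andbT. Qed.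

Lemma blockpart_with_expo b H z :
  blockpart (with_expo b H z) = with_expo b (fun z => blockpart (H z)) z.
Proof. by apply/matrixP => i j; rewrite !mxE mulrnAl. Qed.

Lemma omega_fl i : omega (fl i) = omega i.
Proof. by rewrite /omega flK eq_sym. Qed.

Lemma blk_alpha i j : blk i j -> alpha i = alpha j -> i = j.
Proof.
case/orP => /eqP -> // h; apply/eqP; rewrite eq_sym; apply: contraT => /alpha_fl.
by rewrite h eqxx.
Qed.

Definition ray (w : C) (n : nat) : C := n%:R * w.

Definition expo_ratio b w i j n := expo b (ray w n) i / expo b (ray w n) j.

Lemma expo_ratioE b w i j n : w != 0 -> (0 < n)%N -> expo_ratio b w i j n =
  cexp (n%:R * (w * (U i - U j))) *
  (cexp ((ln n%:R)%:C * (c * ((omega i)%:R - (omega j)%:R))) *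
   cexp (blog b w * (c * ((omega i)%:R - (omega j)%:R)))).
Proof.
move=> w0 n0; rewrite /expo_ratio /expo -cexpN -!cexpD /ray; congr cexp.
have -> : (n%:R : C) = (n%:R)%:C by rewrite rmorph_nat.
by rewrite blog_scale ?ltr0n //; ring.
Qed.

Lemma expo_ratio_moderate b w i j : w != 0 ->
  complex.Im w * (alpha j - alpha i) <= 0 -> moderate (expo_ratio b w i j).
Proof.
move=> w0 h; have [K [K' [n0 H]]] : moderate (fun n =>
    cexp (n%:R * (w * (U i - U j))) *
    (cexp ((ln n%:R)%:C * (c * ((omega i)%:R - (omega j)%:R))) *
    cexp (blog b w * (c * ((omega i)%:R - (omega j)%:R))))).
  apply: moderateM.
    apply: moderate_seqO; apply: seqO_cexp.
    by rewrite /U !ReImE /=; apply: le_trans h; rewrite le_eqVlt; apply/orP; left;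
      apply/eqP; ring.
  by apply: moderateM; [exact: moderate_power|apply: moderate_seqO; exact: seqO_cst].
exists K; exists K'; exists (maxn n0 1) => n; rewrite geq_max => /andP[/H {}H n1].
by rewrite expo_ratioE.
Qed.

Lemma expo_ratio_rapid b w i j : w != 0 ->
  complex.Im w * (alpha j - alpha i) < 0 -> rapid (expo_ratio b w i j).
Proof.
move=> w0 h; have : rapid (fun n =>
    cexp (n%:R * (w * (U i - U j))) *
    (cexp ((ln n%:R)%:C * (c * ((omega i)%:R - (omega j)%:R))) *
    cexp (blog b w * (c * ((omega i)%:R - (omega j)%:R))))).
  apply: rapidM.
    apply: rapid_cexp.
    by rewrite /U !ReImE /=; apply: le_lt_trans h; rewrite le_eqVlt; apply/orP; left;
      apply/eqP; ring.
  by apply: moderateM; [exact: moderate_power|apply: moderate_seqO; exact: seqO_cst].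
by apply: (@rapid_evt _ _ _ 1) => n n1; rewrite expo_ratioE.
Qed.

Lemma expo_ratioK b w i j n : expo_ratio b w i j n * expo_ratio b w j i n = 1.
Proof. by rewrite /expo_ratio mulrA divfK ?mulfV ?expo_neq0. Qed.

(** The constant equals G_n e_j / e_i along the ray. It decreases rapidly either because the ratio
    decays exponentially and G is bounded, or because G is rapid and the ratio grows at most
    polynomially. *)
Lemma coef_eq0 b w i j (G : nat -> C) a (n0 : nat) : w != 0 ->
  (forall n, (n0 <= n)%N -> G n = expo_ratio b w i j n * a) ->
  (seqO 0 G /\ complex.Im w * (alpha i - alpha j) < 0) \/
  (rapid G /\ complex.Im w * (alpha i - alpha j) <= 0) -> a = 0.
Proof.
move=> w0 HG h; apply: rapid_cst.
suff : rapid (fun n => G n * expo_ratio b w j i n).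
  apply: (@rapid_evt _ _ _ n0) => n /HG ->.
  by rewrite mulrAC expo_ratioK mul1r.
case: h => [[h1 h2]|[h1 h2]]; last by apply: rapidM => //; exact: expo_ratio_moderate.
have := rapidM_seqO (expo_ratio_rapid b w0 h2) h1.
by apply: (@rapid_evt _ _ _ 0) => n _; rewrite mulrC.
Qed.

Lemma quotient_entry b b' z H H' (A : M) i j : H z \in unitmx ->
  with_expo b' H' z = with_expo b H z *m A ->
  (invmx (H z) *m H' z) i j = expo b z i * A i j / expo b' z j.
Proof.
move=> uH; rewrite !with_expoE => /(congr1 (fun X => (invmx (H z) *m X) i j)).
rewrite -mulmxA mulKmx // mulmxA mul_mx_diag mul_diag_mx !mxE => h.
by apply: (canRL (mulfK (expo_neq0 _ _ _))).
Qed.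

Variables (Hf : nat -> M) (Hp Hm : C -> M) (S : M).
Hypothesis Hf0 : Hf 0%N = 1%:M.
Hypothesis formalE : forall l i j,
  - (l%:R * Hf l i j) + Hf l.+1 i j * (U j - U i) + c * (omega j)%:R * Hf l i j
  = c * Hf l (fl i) j.
(** Rays off the real axis lie in both supersectors, so H_+ and H_- can be compared along any of
    them. *)
Definition ray_asymptotic (H : C -> M) := forall w, complex.Im w != 0 -> forall k i j,
  seqO k (fun n => H (ray w n) i j - \sum_(l < k) ray w n ^- l * Hf l i j).
Hypothesis asym_p : ray_asymptotic Hp.
Hypothesis asym_m : ray_asymptotic Hm.
Local Notation Yp := (with_expo false Hp).
Local Notation Ym := (with_expo true Hm).
Local Notation Hpb := (fun z => blockpart (Hp z)).
Local Notation Hmb := (fun z => blockpart (Hm z)).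
Local Notation Ypb := (with_expo false Hpb).
Local Notation Ymb := (with_expo true Hmb).
Hypothesis sol_p : msol (hp 1) Yp.
Hypothesis sol_pu : msol (hp (- 'i)) Yp.
Hypothesis sol_m : msol (hp (-1)) Ym.
Hypothesis stokesE : forall z, complex.Re z < 0 -> 0 < complex.Im z -> Ym z = Yp z *m S.

(** * Comparison of canonical factors along rays *)

Lemma tends_H H w : ray_asymptotic H -> complex.Im w != 0 ->
  tends_mx (fun n => H (ray w n)) 1%:M.
Proof.
move=> h w0 i j; have := h w w0 1%N i j; apply: seqO_ext => n.
by rewrite big_ord1 expr0 invr1 mul1r Hf0.
Qed.

Lemma tends_Hb H w : ray_asymptotic H -> complex.Im w != 0 ->
  tends_mx (fun n => blockpart (H (ray w n))) 1%:M.
Proof.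
move=> h w0 i j; have [ij|ij] := boolP (blk i j).
  by apply: seqO_ext (tends_H h w0 i j) => n; rewrite [in RHS]mxE ij.
rewrite mxE; case: eqVneq => [e|_]; first by rewrite e blk_refl in ij.
by apply: seqO_ext (tends_cst 0) => n; rewrite mxE (negPf ij).
Qed.

Lemma rapid_HH H H' w : ray_asymptotic H -> ray_asymptotic H' -> complex.Im w != 0 ->
  rapid_mx (fun n => H (ray w n) - H' (ray w n)).
Proof.
move=> h h' w0 i j k; apply: seqO_ext (seqOD (h w w0 k i j) (seqON (h' w w0 k i j))) => n.
by rewrite !mxE; ring.
Qed.

Lemma rapid_HHb H H' w : ray_asymptotic H -> ray_asymptotic H' -> complex.Im w != 0 ->
  rapid_mx (fun n => blockpart (H (ray w n)) - blockpart (H' (ray w n))).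
Proof.
move=> h h' w0 i j; have [ij|ij] := boolP (blk i j).
  by apply: (rapid_evt (n0 := 0)) (rapid_HH h h' w0 i j) => n _; rewrite !mxE ij.
move=> k; apply: seqO_ext (seqO0 _ k) => n; by rewrite !mxE (negPf ij) subrr.
Qed.

(** * Formal solution and resonance *)

Definition resonant := exists l : nat, c = l.+1%:R \/ c = - l.+1%:R.

(** For distinct exponents the recursion gives an entry of order l + 1 from order l. For equal
    exponents outside the blocks it reduces to a multiple of the entry itself, with factor - (l + 1)
    - c if i is fixed by the flip and - (l + 1) + c [omega j] otherwise; neither vanishes off
    resonance. *)
Lemma formal_block : ~ resonant -> forall l, blockmx (Hf l).
Proof.
move=> nr; have step l : (forall i j, ~~ blk i j -> Hf l i j = 0) ->
    forall i j, ~~ blk i j -> alpha i != alpha j -> Hf l.+1 i j = 0.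
  move=> IH i j ij a; have := formalE l i j.
  rewrite (IH i j ij) (IH (fl i) j) ?blk_fll // !mulr0 oppr0 add0r addr0 => /eqP.
  rewrite mulf_eq0 => /orP[/eqP //|]; rewrite subr_eq0 => /eqP[h].
  by rewrite h eqxx in a.
elim => [|l IH] i j ij.
  by rewrite Hf0 mxE; case: eqVneq => // e; rewrite e blk_refl in ij.
have [a|a] := eqVneq (alpha i) (alpha j); last exact: step.
have := formalE l.+1 i j; rewrite /U a subrr mulr0 addr0.
have [fi|fi] := eqVneq (fl i) i.
  rewrite fi; have -> : omega j = false.
    apply/negP => /eqP fj; move: ij; rewrite (alpha_fix fi fj a).
    by rewrite blk_refl.
  rewrite mulr0 mul0r addr0 => /eqP; rewrite -subr_eq0 -mulNr -mulrBl mulf_eq0.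
  case/orP => /eqP // h; case: nr; exists l; right; apply/eqP.
  by rewrite eq_sym -subr_eq0 h.
(* [fl i] and j have distinct exponents, so this entry of the same order is already known to
   vanish. *)
have -> : Hf l.+1 (fl i) j = 0 by apply: step => //;
  rewrite ?blk_fll // -a eq_sym alpha_fl.
rewrite mulr0 -mulNr -mulrDl => /eqP; rewrite mulf_eq0; case/orP => /eqP // h.
case oj : (omega j) h => h.
  case: nr; exists l; left; apply/eqP; rewrite -subr_eq0 -h mulr1; apply/eqP; ring.
by move: h; rewrite mulr0 addr0 => /eqP; rewrite oppr_eq0 pnatr_eq0.
Qed.

(** Outside the blocks all coefficients of the expansion are zero. *)
Lemma rapid_offblock H w : ~ resonant -> ray_asymptotic H -> complex.Im w != 0 ->
  rapid_mx (fun n => H (ray w n) - blockpart (H (ray w n))).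
Proof.
move=> nr h w0 i j k; have [ij|ij] := boolP (blk i j).
  by apply: seqO_ext (seqO0 _ k) => n; rewrite !mxE ij subrr.
apply: seqO_ext (h w w0 k i j) => n; rewrite !mxE (negPf ij) mulr0n subr0.
by rewrite big1 ?subr0 // => l _; rewrite formal_block ?mulr0.
Qed.

Definition dir (x y : RR) : C := x +i* y.

Lemma hp_ray (w w0 : C) n : hp w0 w -> (0 < n)%N -> hp w0 (ray w n).
Proof.
rewrite /hp /ray /= => h n0.
rewrite (_ : w0 * (n%:R * w) = n%:R * (w0 * w)); last by ring.
by rewrite cReM Re_nat Im_nat mul0r subr0 mulr_gt0 // ltr0n.
Qed.

(** * Connection matrices between the canonical solutions and their block parts *)

Lemma unit_far H w : tends_mx (fun n => H (ray w n)) 1%:M ->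
  exists n0 : nat, (0 < n0)%N /\ forall n b, (n0 <= n)%N -> H (ray w n)
    \in unitmx /\ with_expo b H (ray w n) \in unitmx.
Proof.
move=> /tends_unitmx[n0 h]; exists n0.+1; split=> // n b n1.
by rewrite with_expo_unit; split; apply: h; rewrite ltnW.
Qed.

(** Far out on the ray H is close to 1, hence invertible; the constant is read off at one such point
    and uniqueness propagates it. *)
Lemma connection w0 w b (H : C -> M) Y : hp w0 w ->
  tends_mx (fun n => H (ray w n)) 1%:M ->
  msol (hp w0) (with_expo b H) -> msol (hp w0) Y ->
  exists A : M, forall z, hp w0 z -> Y z = with_expo b H z *m A.
Proof.
move=> hw /unit_far[n [n0 /(_ n b (leqnn _))[_ u]]] sH sY.
exists (invmx (with_expo b H (ray w n)) *m Y (ray w n)) => z hz.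
apply: (msol_eq sY (msol_mulmx _ sH) (hp_ray hw n0) hz).
by rewrite mulKVmx.
Qed.

Lemma sol_pb : msol (hp 1) Ypb.
Proof.
move=> z hz i j; have := msol_blockpart flK sol_p hz.
move=> /(_ i j); rewrite blockpart_with_expo; apply: cderiv_at_ext => x.
by rewrite blockpart_with_expo.
Qed.
Lemma sol_pub : msol (hp (- 'i)) Ypb.
Proof.
move=> z hz i j; have := msol_blockpart flK sol_pu hz.
move=> /(_ i j); rewrite blockpart_with_expo; apply: cderiv_at_ext => x.
by rewrite blockpart_with_expo.
Qed.
Lemma sol_mb : msol (hp (-1)) Ymb.
Proof.
move=> z hz i j; have := msol_blockpart flK sol_m hz.
move=> /(_ i j); rewrite blockpart_with_expo; apply: cderiv_at_ext => x.
by rewrite blockpart_with_expo.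
Qed.


Lemma unit_far_block H w : ray_asymptotic H -> complex.Im w != 0 ->
  exists n0 : nat, (0 < n0)%N /\ forall n b, (n0 <= n)%N ->
    blockpart (H (ray w n)) \in unitmx /\
    with_expo b (fun z => blockpart (H z)) (ray w n) \in unitmx.
Proof. by move=> h w0; apply: (@unit_far (fun z => blockpart (H z)));
  exact: tends_Hb. Qed.

Lemma connection_entry b w H A n i j : blockpart (H (ray w n)) \in unitmx ->
  with_expo b H (ray w n) = with_expo b (fun z => blockpart (H z)) (ray w n) *m A ->
  (invmx (blockpart (H (ray w n))) *m H (ray w n)) i j = expo_ratio b w i j n * A i j.
Proof.
by move=> u /quotient_entry -> //; rewrite /expo_ratio mulrAC.
Qed.

Lemma Im_dir x y : complex.Im (dir x y) = y. Proof. by []. Qed.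

Lemma dir_neq0 x y : y != 0 -> dir x y != 0.
Proof. by apply: contraNneq => -[_ ->]. Qed.

Lemma hp_dir x y : x != 0 -> hp x%:C (dir x y).
Proof. by move=> x0; rewrite /hp /= mul0r subr0 -expr2 lt_def sqr_ge0 sqrf_eq0 x0. Qed.

Lemma connection_offdiag b (x : RR) H A i j : x != 0 -> ray_asymptotic H ->
  (forall z, hp x%:C z -> with_expo b H z = with_expo b (fun z => blockpart (H z))
    z *m A) ->
  alpha i != alpha j -> A i j = 0.
Proof.
(* The sign of [y] makes e_j / e_i decay along the ray; the half plane contains rays of both
   kinds. *)
move=> x0 aH HA aij; set y : RR := if alpha i < alpha j then 1 else -1.
have y0 : y != 0 by rewrite /y; case: ifP; rewrite ?oppr_eq0 oner_eq0.
have w0 : complex.Im (dir x y) != 0 by [].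
have [n0 [n0p H0]] := unit_far_block aH (w0).
apply: (@coef_eq0 b (dir x y) i j (fun n => (invmx (blockpart (H (ray (dir x y) n)))
  *m H (ray (dir x y) n)) i j) _ n0).
- exact: dir_neq0.
- move=> n nn; apply: connection_entry; first by case: (H0 n b nn).
  by apply: HA; apply: hp_ray; [exact: hp_dir|exact: leq_trans nn].
left; split.
  have := tends_mulmx (tends_invmx (tends_Hb aH w0)) (tends_H aH w0).
  by move=> /(_ i j) /tends_seqO.
rewrite Im_dir /y; case: (ltgtP (alpha i) (alpha j)) aij => //= h _;
  last by rewrite mulN1r oppr_lt0 subr_gt0.
by rewrite mul1r subr_lt0.
Qed.

(** For equal exponents the ratio is only a power of n, which is beaten by the rapid decay of the
    off-block part of H. *)
Lemma connection_nonres b (x : RR) H A : x != 0 -> ray_asymptotic H ->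
  (forall z, hp x%:C z -> with_expo b H z = with_expo b (fun z => blockpart (H z))
    z *m A) ->
  ~ resonant -> A = 1%:M.
Proof.
move=> x0 aH HA nr; apply/matrixP => i j; apply/eqP; rewrite -subr_eq0; apply/eqP.
have [aij|aij] := eqVneq (alpha i) (alpha j); last first.
  have [ij|ij] := eqVneq i j; first by rewrite ij eqxx in aij.
  by rewrite (connection_offdiag x0 aH HA aij) mxE (negPf ij) subrr.
have w0 : complex.Im (dir x 1) != 0 by rewrite /= oner_eq0.
have [n0 [n0p H0]] := unit_far_block aH (w0).
apply: (@coef_eq0 b (dir x 1) i j (fun n => (invmx (blockpart (H (ray (dir x 1) n)))
  *m H (ray (dir x 1) n) - 1%:M) i j) _ n0).
- by apply: dir_neq0; rewrite oner_eq0.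
- move=> n nn; rewrite [LHS]mxE [X in _ + X]mxE mulrBr; congr (_ - _).
    apply: connection_entry; first by case: (H0 n b nn).
    by apply: HA; apply: hp_ray; [exact: hp_dir|exact: leq_trans nn].
  rewrite mxE; case: eqVneq => [->|]; last by rewrite mulr0.
  by rewrite mulr1 /expo_ratio mulfV ?expo_neq0.
right; split; last by rewrite aij subrr mulr0.
exact: (rapid_quotient (tends_Hb aH w0) (rapid_offblock nr aH w0) i j).
Qed.

Local Notation full_turn := (0 +i* (pi *+ 2) : C).
Local Notation half_turn := (0 +i* pi : C).

Lemma expo_true_false z j : 0 < complex.Im z ->
  expo true z j = expo false z j * cexp (- (full_turn * (c * (omega j)%:R))).
Proof. by move=> z0; rewrite /expo blog_true_false // -cexpD; congr cexp; ring. Qed.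

Lemma resonant_turn : resonant -> cexp (full_turn * c) = 1.
Proof.
have E l : cexp (full_turn * l%:R) = 1.
  by rewrite mulr_natr cexpMn cexp_2pi expr1n.
by move=> [l [->|->]]; rewrite ?mulrN ?cexpN E ?invr1.
Qed.

(** The right and upper half planes overlap in the first quadrant, so their two constants
    coincide. *)
Lemma connection_p : exists A : M, forall z, hp 1 z \/ hp (- 'i) z -> Yp z = Ypb z *m A.
Proof.
have w0 : complex.Im (dir 1 1) != 0 by rewrite /= oner_eq0.
have h1 : hp 1 (dir 1 1) by rewrite hp1.
have h2 : hp (- 'i) (dir 1 1) by rewrite hp_imag.
have tb := tends_Hb asym_p w0.
have [A HA] := connection (H := Hpb) h1 tb sol_pb sol_p.
have [B HB] := connection (H := Hpb) h2 tb sol_pub sol_pu.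
have AB : A = B.
  have [n [n0 /(_ n false (leqnn _))[_ u]]] := unit_far_block asym_p w0.
  have := HB _ (hp_ray h2 n0); rewrite (HA _ (hp_ray h1 n0)).
  by move/(congr1 (mulmx (invmx (Ypb (ray (dir 1 1) n))))); rewrite !mulKmx.
by exists A => z [/HA|/HB]; rewrite ?AB.
Qed.

Lemma connection_m : exists A : M, forall z, hp (-1) z -> Ym z = Ymb z *m A.
Proof.
have w0 : complex.Im (dir (-1) 1) != 0 by rewrite /= oner_eq0.
have h1 : hp (-1) (dir (-1) 1) by rewrite hpN1 /= oppr_lt0.
exact: (connection (H := Hmb) h1 (tends_Hb asym_m w0) sol_mb sol_m).
Qed.

(** At resonance A and B need not be 1, but they agree. Entries with distinct exponents vanish in
    both; the others are compared in the second quadrant, where both relations hold and H_+ and H_-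
    share their expansion to all orders. *)
Lemma connection_common : exists A : M,
  [/\ forall z, hp 1 z \/ hp (- 'i) z -> Yp z = Ypb z *m A,
      forall z, hp (-1) z -> Ym z = Ymb z *m A & resonant \/ A = 1%:M].
Proof.
have [A HA] := connection_p; have [B HB] := connection_m.
have HA' z : hp (1 : RR)%:C z -> Yp z = Ypb z *m A by move=> h; apply: HA; left.
have HB' z : hp (-1 : RR)%:C z -> Ym z = Ymb z *m B by rewrite rmorphN1; exact: HB.
have x1 : (1 : RR) != 0 by rewrite oner_eq0.
have x2 : (-1 : RR) != 0 by rewrite oppr_eq0 oner_eq0.
have [r|nr] := pselect resonant; last first.
  exists 1%:M; split; last by right.
    by move=> z /HA; rewrite (connection_nonres x1 asym_p HA' nr).
  by move=> z /HB; rewrite (connection_nonres x2 asym_m HB' nr).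
suff AB : A = B by exists A; split=> //; [rewrite AB|left].
apply/matrixP => i j.
have [aij|aij] := eqVneq (alpha i) (alpha j); last first.
  by rewrite (connection_offdiag x1 asym_p HA' aij)
    (connection_offdiag x2 asym_m HB' aij).
set w := dir (-1) 1; have w0 : complex.Im w != 0 by rewrite /= oner_eq0.
have [n0 [n0p H0]] := unit_far_block asym_p (w0).
have [n1 [n1p H1]] := unit_far_block asym_m (w0).
apply/eqP; rewrite -subr_eq0; apply/eqP.
apply: (@coef_eq0 false w i j (fun n => (invmx (blockpart (Hp (ray w n))) *m Hp (ray w n)
   - invmx (blockpart (Hm (ray w n))) *m Hm (ray w n)) i j) _ (maxn n0 n1)).
- by apply: dir_neq0; rewrite oner_eq0.
- move=> n; rewrite geq_max => /andP[nn0 nn1].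
  have hi : hp (- 'i) w by rewrite hp_imag.
  have hm : hp (-1) w by rewrite hpN1 /= oppr_lt0.
  have n_gt0 := leq_trans n0p nn0.
  rewrite [LHS]mxE [X in _ + X]mxE mulrBr; congr (_ - _).
    apply: connection_entry; first by case: (H0 n false nn0).
    by apply: HA; right; exact: hp_ray.
  rewrite (@connection_entry true _ _ B); first last.
  - by apply: HB; exact: hp_ray.
  - by case: (H1 n true nn1).
  have zi : 0 < complex.Im (ray w n) by have := hp_ray hi n_gt0; rewrite hp_imag.
  (* At resonance the formal monodromy is trivial, so the branches of the logarithm give the same
     exponentials. *)
  have tf k : expo true (ray w n) k = expo false (ray w n) k.
    rewrite expo_true_false // mulrA cexpN; case: omega.
      by rewrite mulr1 resonant_turn // invr1 mulr1.
    by rewrite mulr0 cexp0 invr1 mulr1.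
  by rewrite /expo_ratio !tf.
right; split; last by rewrite aij subrr mulr0.
exact: (rapid_quotient2 (tends_Hb asym_p w0) (tends_Hb asym_m w0) (tends_H asym_m w0)
  (rapid_HHb asym_m asym_p w0) (rapid_HH asym_p asym_m w0) i j).
Qed.

(** With the same A on both sides, the Stokes relation conjugated by A becomes a relation between
    the block parts. *)
Lemma stokes_block : exists T A : M,
  [/\ A \in unitmx, S = invmx A *m T *m A, resonant \/ A = 1%:M &
      forall z, complex.Re z < 0 -> 0 < complex.Im z -> Ymb z = Ypb z *m T].
Proof.
have [A [HA HB r]] := connection_common.
have w0 : complex.Im (dir 1 1) != 0 by rewrite /= oner_eq0.
have [n [np /(_ n false (leqnn _))[_ u]]] := unit_far (H := Hp) (tends_H asym_p w0).
have uA : A \in unitmx.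
  move: u; rewrite HA ?unitmx_mul; first by case/andP.
  by left; apply: hp_ray => //; rewrite hp1.
exists (A *m S *m invmx A), A; split=> //.
  by rewrite !mulmxA mulVmx // mul1mx mulmxKV.
move=> z zr zi; rewrite !mulmxA -HA; last by right; rewrite hp_imag.
by rewrite -stokesE // HB ?hpN1 // mulmxK.
Qed.

(** * Symmetry under the flip combined with z -> - z *)

Definition half_plane_flip (z : C) : M := \matrix_(i, j) Hpb (- z) (fl i) (fl j).
Local Notation Ht := half_plane_flip.
Local Notation Yt := (with_expo true Ht).

Lemma blk_U i j : blk i j -> U i + U (fl i) = U j + U (fl j).
Proof. by case/orP => /eqP ->; rewrite // flK addrC. Qed.

(** U_j + U_(fl j) is constant on a block, so e^(z U_j) is a block scalar times the exponential for
    [fl j] at - z; the half turn is the shift in [blog_opp]. *)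
Lemma YtE z i j : Yt z i j =
  cexp (z * (U i + U (fl i))) * Ypb (- z) (fl i) (fl j)
    * cexp (- (half_turn * (c * (omega j)%:R))).
Proof.
rewrite !mxE; have [ij|ij] := boolP (blk (fl i) (fl j));
  last by rewrite !mulr0n !(mul0r, mulr0).
rewrite /expo !mulr1n omega_fl [X in _ = X * _]mulrCA -[RHS]mulrA -!cexpD;
  congr (_ * cexp _).
move: ij; rewrite blk_fll // blk_flr // => /blk_U ->.
by rewrite blog_opp; ring.
Qed.

(** Under z -> - z the term c / z is preserved and U_(fl i) changes sign; the derivative of the
    scalar factor restores U_i. *)
Lemma sol_t : msol (hp (-1)) Yt.
Proof.
move=> z hz i j.
have hz' : hp 1 (- z) by move: hz; rewrite hpN1 hp1 cReN oppr_gt0.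
have z0 : z != 0 by move: hz; rewrite hpN1; apply: contraTneq => ->; rewrite ltxx.
have h1 := cderiv_at_opp (sol_pb hz' (fl i) (fl j)).
have h2 : cderiv_at (fun z => cexp (z * (U i + U (fl i)))) z ((U i + U (fl i))
  * cexp (z * (U i + U (fl i)))).
  apply: cderiv_at_cexp; apply: cderiv_at_eq (cderiv_atM (@cderiv_at_id RR z)
    (@cderiv_at_cst RR (U i + U (fl i)) z)) _.
  by rewrite mulr0 addr0 mul1r.
have := cderiv_atM (cderiv_atM h2 h1)
  (@cderiv_at_cst RR (cexp (- (half_turn * (c * (omega j)%:R)))) z).
move=> H; apply: cderiv_at_eq (cderiv_at_ext _ H) _; first by move=> x; rewrite YtE.
rewrite !YtE !flK [U (fl i) + U i]addrC invrN; ring.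
Qed.

Lemma tends_Ht w : complex.Im w != 0 -> tends_mx (fun n => Ht (ray w n)) 1%:M.
Proof.
move=> w0 i j; have w0' : complex.Im (- w) != 0 by rewrite cImN oppr_eq0.
have := tends_Hb asym_p w0' (fl i) (fl j).
rewrite !mxE (inj_eq (inv_inj flK)); apply: seqO_ext => n.
by rewrite [in RHS]mxE /ray mulrN.
Qed.

Lemma blockmx_expo b H z : blockmx (H z) -> blockmx (with_expo b H z).
Proof. by move=> h i j /h; rewrite mxE => ->; rewrite mul0r. Qed.

Lemma blockmx_Ht z : blockmx (Ht z).
Proof. by move=> i j ij; rewrite mxE blockpartP // blk_fll // blk_flr. Qed.

(* The symmetry exchanging the two factors of the tensor product. *)
Lemma flip_symmetry z : complex.Re z < 0 -> Ymb z = Yt z.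
Proof.
have h x y : x < 0 -> hp (-1) (dir x y) by rewrite hpN1.
have N1 : (-1 : RR) < 0 by rewrite oppr_lt0.
have i1 y : y != 0 -> complex.Im (dir (-1) y) != 0 by [].
have [D HD] := connection (H := Hmb) (h _ 1 N1) (tends_Hb asym_m (i1 _ (oner_neq0 _)))
  sol_mb sol_t.
suff D1 : D = 1%:M by move=> z0; rewrite HD ?hpN1 // D1 mulmx1.
have entry y : y != 0 -> exists n0 : nat, forall n i j, (n0 <= n)%N ->
    (invmx (Hmb (ray (dir (-1) y) n)) *m Ht (ray (dir (-1) y) n)) i j
    = expo_ratio true (dir (-1) y) i j n * D i j.
  move=> y0; have [n0 [n0p H0]] := unit_far_block asym_m ((i1 _ y0)).
  exists n0 => n i j nn; rewrite /expo_ratio mulrAC;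
    apply: (@quotient_entry true true _ Hmb).
    by case: (H0 n true nn).
  by apply: HD; apply: hp_ray; [exact: h|exact: leq_trans nn].
have tG y : y != 0 -> tends_mx (fun n => invmx (Hmb (ray (dir (-1) y) n))
  *m Ht (ray (dir (-1) y) n)) 1%:M.
  move=> y0; have := tends_mulmx (tends_invmx (tends_Hb asym_m (i1 _ y0)))
    (tends_Ht (i1 _ y0)).
  by rewrite mulmx1.
(* Both solutions are block matrices, hence so is [D]. This disposes of distinct indices with equal
   exponents, for which no ray yields decay. *)
have bD : blockmx D.
  have [n0 [n0p /(_ _ true (leqnn n0))[_ u]]] := unit_far_block asym_m ((i1 _
    (oner_neq0 _))).
  apply: (blockmx_cancel flK (A := Ymb (ray (dir (-1) 1) n0))) => //.
    by apply: blockmx_expo; exact: blockpartP.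
  rewrite -HD; first by apply: blockmx_expo; exact: blockmx_Ht.
  by apply: hp_ray => //; exact: h.
apply/matrixP => i j; have [->|ij] := eqVneq i j.
  have [n0 H0] := entry _ (oner_neq0 _).
  apply: (@tends_uniq _ (fun=> D j j)); first exact: tends_cst.
  have := tG _ (oner_neq0 _) j j; apply: (@seqO_evt _ _ _ _ n0) => n nn.
  by rewrite H0 // /expo_ratio mulfV ?mul1r ?expo_neq0.
rewrite [RHS]mxE (negPf ij).
have [aij|aij] := eqVneq (alpha i) (alpha j).
  by apply: bD; apply: contraNN ij => /blk_alpha /(_ aij) ->.
set y : RR := if alpha i < alpha j then 1 else -1.
have y0 : y != 0 by rewrite /y; case: ifP; rewrite ?oppr_eq0 oner_eq0.
have [n0 H0] := entry _ y0.
apply: (@coef_eq0 true (dir (-1) y) i j _ _ n0) => [|n nn|];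
  [exact: dir_neq0|exact: H0|left; split].
  exact: tends_seqO (tG _ y0 i j).
rewrite Im_dir /y; case: (ltgtP (alpha i) (alpha j)) aij => //= ha _;
  last by rewrite mulN1r oppr_lt0 subr_gt0.
by rewrite mul1r subr_lt0.
Qed.

(** * The Stokes matrix of the block parts *)

Section StokesBlock.
Variable T : M.
Hypothesis HT : forall z, complex.Re z < 0 -> 0 < complex.Im z -> Ymb z = Ypb z *m T.

Let w := dir (-1) 1.
Let w0 : complex.Im w != 0. Proof. by rewrite /= oner_eq0. Qed.
Let hwr n : (0 < n)%N -> complex.Re (ray w n) < 0.
Proof.
move=> n0; have h : hp (-1) w by rewrite hpN1 /= oppr_lt0.
by have := hp_ray h n0; rewrite hpN1.
Qed.
Let hwi n : (0 < n)%N -> 0 < complex.Im (ray w n).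
Proof.
move=> n0; have h : hp (- 'i) w by rewrite hp_imag.
by have := hp_ray h n0; rewrite hp_imag.
Qed.

Lemma stokes_block_blockmx : blockmx T.
Proof.
have [n0 [n0p /(_ _ false (leqnn n0))[_ u]]] := unit_far_block asym_p (w0).
apply: (blockmx_cancel flK (A := Ypb (ray w n0))) => //.
  by apply: blockmx_expo; exact: blockpartP.
by rewrite -HT ?hwr ?hwi //; apply: blockmx_expo; exact: blockpartP.
Qed.

(** In the second quadrant H_+^-1 H_- is rapidly close to 1, and for these i and j the factor e_j /
    e_i grows at most polynomially. Only the full turn between the branches remains, on the
    diagonal. *)
Lemma stokes_block_entry i j : alpha i <= alpha j ->
  T i j = cexp (- (full_turn * (c * (omega j)%:R))) *+ (i == j).
Proof.
move=> aij; have [n0 [n0p H0]] := unit_far_block asym_p (w0).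
have /eqP : T i j * cexp (full_turn * (c * (omega j)%:R)) - (i == j)%:R = 0.
  apply: (@coef_eq0 false w i j (fun n => (invmx (Hpb (ray w n)) *m Hmb (ray w n)
    - 1%:M) i j) _ n0).
  - by apply: dir_neq0; rewrite oner_eq0.
  - move=> n nn; have n_gt0 := leq_trans n0p nn.
    rewrite [LHS]mxE [X in _ + X]mxE mulrBr; congr (_ - _).
      rewrite (@quotient_entry false true _ Hpb Hmb T); first last.
      - by rewrite -HT ?hwr ?hwi.
      - by case: (H0 n true nn).
      rewrite /expo_ratio expo_true_false ?hwi // invfM cexpN invrK; ring.
    rewrite mxE; case: eqVneq => [->|]; last by rewrite mulr0.
    by rewrite mulr1 /expo_ratio mulfV ?expo_neq0.
  right; split; last by rewrite /= mul1r subr_le0.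
  exact: (rapid_quotient (tends_Hb asym_p w0) (rapid_HHb asym_m asym_p w0) i j).
rewrite subr_eq0 => /eqP h; rewrite cexpN -[LHS](mulfK (cexp_neq0 (full_turn * (c *
  (omega j)%:R)))) h.
by case: eqP; rewrite ?mul1r ?mul0r.
Qed.

Lemma unit_Ypb z : hp 1 z -> Ypb z \in unitmx.
Proof.
move=> hz; have w0' : complex.Im (dir 1 1) != 0 by rewrite /= oner_eq0.
have [n0 [n0p /(_ _ false (leqnn n0))[_ u]]] := unit_far_block asym_p w0'.
by apply: (msol_unit sol_pb _ hz u); apply: hp_ray => //; rewrite hp1.
Qed.

Lemma unit_stokes_block : T \in unitmx.
Proof.
have [n0 [n0p /(_ _ true (leqnn n0))[_ u]]] := unit_far_block asym_m w0.
by move: u; rewrite HT ?hwr ?hwi // unitmx_mul => /andP[].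
Qed.

Lemma big_blk (F : 'I_N -> C) i : fl i != i -> \sum_(k | blk i k) F k = F i + F (fl i).
Proof.
move=> fi; rewrite (bigD1 i) ?blk_refl //= (bigD1 (fl i)) ?blk_fl //=.
by rewrite big1 ?addr0 // => k /andP[/andP[/orP[]/eqP -> ]]; rewrite ?eqxx.
Qed.

Lemma blockmx_mulE (A B : M) i k j : blockmx A -> fl i != i -> blk i k ->
  (A *m B) k j = A k i * B i j + A k (fl i) * B (fl i) j.
Proof.
move=> bA fi ik; rewrite mxE -(big_blk (fun l => A k l * B l j)) //.
rewrite [RHS]big_mkcond; apply: eq_bigr => l _; case: ifP => // il.
by rewrite bA ?mul0r // -(blk_trans flK _ ik) il.
Qed.

Local Notation q := (half_turn * c).

(* The half-monodromy of the system around 0, composed with the flip, has     *)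
(* trace e^q - e^-q on each two-dimensional block (computed near 0), and this *)
(* trace is minus the off-diagonal Stokes entry (computed at infinity).       *)
Lemma stokes_block_offdiag i : alpha (fl i) < alpha i ->
  T i (fl i) = cexp (- q) - cexp q.
Proof.
move=> ai; have fi : fl i != i by apply: contraTneq ai => ->; rewrite ltxx.
have oi : omega i = false by apply/negbTE.
have of' : omega (fl i) = false by rewrite omega_fl.
(* On this block T is unipotent, so its inverse [W] is obtained by changing the sign of the
   off-diagonal entry. *)
set W := invmx T; have TW : T *m W = 1%:M by rewrite mulmxV // unit_stokes_block.
have Tff : T (fl i) (fl i) = 1.
  by rewrite stokes_block_entry // eqxx of' !mulr0 oppr0 cexp0.
have Tfi : T (fl i) i = 0 by rewrite stokes_block_entry ?(negPf fi) // ltW.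
have Tii : T i i = 1 by rewrite stokes_block_entry // eqxx oi !mulr0 oppr0 cexp0.
have mulE k j : blk i k -> (T *m W) k j = T k i * W i j + T k (fl i) * W (fl i) j.
  by move=> ik; apply: blockmx_mulE => //; exact: stokes_block_blockmx.
have W1 : W (fl i) i = 0.
  have := mulE (fl i) i (blk_fl fl i);
    rewrite TW mxE (negPf fi) Tfi Tff mul0r add0r mul1r.
  by move=> <-.
have W2 : W (fl i) (fl i) = 1.
  have := mulE (fl i) (fl i) (blk_fl fl i); rewrite TW mxE eqxx Tfi Tff mul0r add0r mul1r.
  by move=> <-.
have W3 : W i (fl i) = - T i (fl i).
  have := mulE i (fl i) (blk_refl fl i);
    rewrite TW mxE eq_sym (negPf fi) Tii W2 mul1r mulr1.
  by move=> /eqP; rewrite eq_sym addr_eq0 => /eqP.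
pose p n : C := arc_point RR n.
pose V n := Ypb (- p n) *m invmx (Ypb (p n)).
(* [A] is e^(- i pi c [Omega]) P W. Up to a scalar on the block, P [V n] has the same diagonal
   entries as the conjugate of [A] by [Ypb (p n)]. *)
pose A : M := \matrix_(k, l) (cexp (- (half_turn * (c * (omega k)%:R))) * W (fl k) l).
have VE n k : V n (fl k) k =
    cexp (- p n * (U k + U (fl k))) * (Ypb (p n) *m A *m invmx (Ypb (p n))) k k.
  have [pr pi'] := hp_arc_pointN RR n.
  have -> : V n = Yt (- p n) *m W *m invmx (Ypb (p n)).
    by rewrite -flip_symmetry // HT // mulmxK ?unit_stokes_block.
  rewrite !mxE mulr_sumr; apply: eq_bigr => l _.
  rewrite mulrA; congr (_ * _); rewrite !mxE mulr_sumr.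
  rewrite (reindex_inj (inv_inj flK)) /=; apply: eq_bigr => h _.
  rewrite YtE opprK !flK omega_fl [A h l]mxE [U (fl k) + U k]addrC; ring.
have sumV n : \sum_(k | blk i k) V n (fl k) k =
    cexp (- p n * (U i + U (fl i))) * (A i i + A (fl i) (fl i)).
  rewrite -(big_blk (fun k => A k k)) // -(block_trace flK A i (Y := Ypb (p n)));
    first last.
  - exact: unit_Ypb (hp_arc_point RR n).
  - by apply: blockmx_expo; exact: blockpartP.
  by rewrite mulr_sumr; apply: eq_bigr => k ik; rewrite VE (blk_U ik).
have lim k j := arc_limit flK sol_pb sol_pub unit_Ypb k j.
(* Trace of P e^(q P) on the block, from the arcs shrinking to 0. *)
have L1 : tends (fun n => \sum_(k | blk i k) V n (fl k) k) (csh q + csh q).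
  have h k : fl k != k -> tends (fun n => V n (fl k) k) (csh q).
    move=> fk; have := lim (fl k) k.
    by rewrite flK eqxx (negPf fk) mulr0 add0r mulr1.
  have fi' : fl (fl i) != fl i by rewrite flK eq_sym.
  have := tendsD (h i fi) (h (fl i) fi'); apply: seqO_ext => n.
  by rewrite big_blk.
have L2 : tends (fun n => \sum_(k | blk i k) V n (fl k) k) (A i i + A (fl i) (fl i)).
  have h := tends_cexp_arc_point (- (U i + U (fl i))).
  have := tendsM h (tends_cst (A i i + A (fl i) (fl i))).
  by rewrite mul1r; apply: seqO_ext => n; rewrite sumV mulNr mulrN.
have := tends_uniq L1 L2.
rewrite !mxE flK oi of' !mulr0 oppr0 cexp0 !mul1r W1 W3 add0r => h.
by rewrite -[LHS]opprK -h /csh; field.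
Qed.

End StokesBlock.

Definition stokes_entry (i j : 'I_N) : C :=
  if i == j then cexp (- (full_turn * (c * (omega i)%:R)))
  else if (j == fl i) && (alpha j < alpha i)
  then cexp (- (half_turn * c)) - cexp (half_turn * c) else 0.

(** Off resonance S is T. At resonance A is unknown, but e^(2 q) = 1 makes T the identity, which no
    conjugation changes. *)
Theorem stokes_matrixE i j : S i j = stokes_entry i j.
Proof.
have [T [A [uA SE r HT]]] := stokes_block.
have TE k l : T k l = stokes_entry k l.
  rewrite /stokes_entry; have [<-|kl] := eqVneq k l.
    by rewrite stokes_block_entry // eqxx.
  have [a|a] := leP (alpha k) (alpha l);
    first by rewrite andbF stokes_block_entry // (negPf kl).
  rewrite andbT; case: eqVneq => [e|e]; first by move: a;
    rewrite e => /(stokes_block_offdiag HT).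
  by apply: (stokes_block_blockmx HT); rewrite /blk negb_or e eq_sym kl.
case: r => [r|A1]; last by rewrite SE A1 invmx1 mul1mx mulmx1 TE.
have E k l : stokes_entry k l = (k == l)%:R.
  rewrite /stokes_entry; case: eqP => _.
    rewrite mulrA cexpN; case: omega; last by rewrite mulr0 cexp0 invr1.
    by rewrite mulr1 resonant_turn // invr1.
  case: ifP => // _; apply/eqP; rewrite subr_eq0 cexpN; apply/eqP.
  apply: (mulIf (cexp_neq0 (half_turn * c))); rewrite mulVf ?cexp_neq0 // -cexpD.
  rewrite -mulrDl -[LHS](resonant_turn r); congr (cexp (_ * c)).
  by apply: complex_ext; rewrite ReImE /= ?addr0 // mulr2n.
have T1 : T = 1%:M by apply/matrixP => k l; rewrite TE E mxE.
by rewrite SE T1 mulmx1 mulVmx // mxE E.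
Qed.

End Canonical.

(** * Yang-Baxter equation *)

Section YangBaxter.
Variables (F : fieldType) (m : nat).
Implicit Types (A : 'M[F]_(m * m)) (i j k l a b : 'I_m).

Let sum_eq (f : 'I_m -> F) i : \sum_a f a * (i == a)%:R = f i.
Proof.
rewrite (bigD1 i) //= eqxx mulr1 big1 ?addr0 // => a.
by rewrite eq_sym => /negPf ->; rewrite mulr0.
Qed.

Let sum_eq4 (f g : 'I_m -> 'I_m -> 'I_m -> 'I_m -> F) i j k l :
  (forall a b c d, g a b c d =
     f a b c d * (l == d)%:R * (k == c)%:R * (j == b)%:R * (i == a)%:R) ->
  \sum_a \sum_b \sum_c \sum_d g a b c d = f i j k l.
Proof.
move=> gE; under eq_bigr do under eq_bigr do under eq_bigr do
  (under eq_bigr do rewrite gE; rewrite -!mulr_suml sum_eq).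
under eq_bigr do under eq_bigr do rewrite -!mulr_suml sum_eq.
under eq_bigr do rewrite -!mulr_suml sum_eq.
by rewrite sum_eq.
Qed.

Let sum_mxE n (f : 'I_m -> 'I_m -> 'I_m -> 'I_m -> 'M[F]_n) (x y : 'I_n) :
  (\sum_a \sum_b \sum_c \sum_d f a b c d) x y =
  \sum_a \sum_b \sum_c \sum_d f a b c d x y.
Proof. by do 4![rewrite summxE; apply: eq_bigr => ? _]. Qed.

Definition idx3 i j k : 'I_(m * m * m) := mxtens_index (mxtens_index (i, j), k).

Lemma leg12E A i1 i2 i3 j1 j2 j3 : leg12 A (idx3 i1 i2 i3) (idx3 j1 j2 j3) =
  tens_coef A i1 j1 i2 j2 * (i3 == j3)%:R.
Proof.
rewrite sum_mxE; apply: (sum_eq4 (f := fun a b c d => tens_coef A a b c d * (i3 ==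
  j3)%:R)).
by move=> a b c d; rewrite [LHS]mxE !tensmxE !mxE -!mulnb !natrM; ring.
Qed.

Lemma leg13E A i1 i2 i3 j1 j2 j3 : leg13 A (idx3 i1 i2 i3) (idx3 j1 j2 j3) =
  tens_coef A i1 j1 i3 j3 * (i2 == j2)%:R.
Proof.
rewrite sum_mxE; apply: (sum_eq4 (f := fun a b c d => tens_coef A a b c d * (i2 ==
  j2)%:R)).
by move=> a b c d; rewrite [LHS]mxE !tensmxE !mxE -!mulnb !natrM; ring.
Qed.

Lemma leg23E A i1 i2 i3 j1 j2 j3 : leg23 A (idx3 i1 i2 i3) (idx3 j1 j2 j3) =
  tens_coef A i2 j2 i3 j3 * (i1 == j1)%:R.
Proof.
rewrite sum_mxE; apply: (sum_eq4 (f := fun a b c d => tens_coef A a b c d * (i1 ==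
  j1)%:R)).
by move=> a b c d; rewrite [LHS]mxE !tensmxE !mxE -!mulnb !natrM; ring.
Qed.

Lemma sum_idx3 (f : 'I_(m * m * m) -> F) :
  \sum_h f h = \sum_i \sum_j \sum_k f (idx3 i j k).
Proof.
have R n p (g : 'I_(n * p) -> F) : \sum_h g h = \sum_i \sum_j g (mxtens_index (i, j)).
  rewrite pair_big /= (reindex (@mxtens_index n p)) /=; last first.
    by exists (@mxtens_unindex n p) => x _; rewrite (mxtens_indexK, mxtens_unindexK).
  by apply: eq_bigr => -[].
by rewrite R R.
Qed.

Variables (R : 'M[F]_(m * m)) (P L : 'I_m -> 'I_m -> F).
(** R is the sum over a and c of P_ac E_aa (x) E_cc + L_ac E_ac (x) E_ca, with at most two nonzero
    entries in each row. *)
Hypothesis RE : forall a b c d, tens_coef R a b c d =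
  P a c * (a == b)%:R * (c == d)%:R + L a c * (a == d)%:R * (c == b)%:R.

Let sum_two (u v : F) a c b d (x : 'I_m -> 'I_m -> F) :
  \sum_i \sum_j (u * (a == i)%:R * (c == j)%:R + v * (b == j)%:R * (d == i)%:R) * x i j
  = u * x a c + v * x d b.
Proof.
have E (w : F) k l : \sum_i \sum_j (w * (k == i)%:R * (l == j)%:R) * x i j = w * x k l.
  rewrite -[RHS](sum_eq (fun i => w * x i l) k); apply: eq_bigr => i _.
  rewrite -[RHS](sum_eq (fun j => w * x i j * (k == i)%:R) l); apply: eq_bigr => j _;
    ring.
rewrite -!E -big_split; apply: eq_bigr => i _; rewrite -big_split;
  apply: eq_bigr => j _ /=; ring.
Qed.

(** A leg acts on rows by combining a row with the one where two indices are exchanged, so triple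
    products can be expanded by rewriting. *)
Lemma leg12_mulE (X : 'M[F]_(m * m * m)) a b c J :
  (leg12 R *m X) (idx3 a b c) J = P a b * X (idx3 a b c) J + L a b * X (idx3 b a c) J.
Proof.
rewrite mxE sum_idx3 -(sum_two (P a b) (L a b) a b a b (fun i j => X (idx3 i j c) J)).
apply: eq_bigr => i _; apply: eq_bigr => j _.
rewrite -[RHS](sum_eq (fun k => (P a b * (a == i)%:R * (b == j)%:R + L a b * (a ==
  j)%:R * (b == i)%:R) * X (idx3 i j k) J) c).
by apply: eq_bigr => k _; rewrite leg12E RE; ring.
Qed.

Lemma leg13_mulE (X : 'M[F]_(m * m * m)) a b c J :
  (leg13 R *m X) (idx3 a b c) J = P a c * X (idx3 a b c) J + L a c * X (idx3 c b a) J.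
Proof.
rewrite mxE sum_idx3 -(sum_two (P a c) (L a c) a c a c (fun i k => X (idx3 i b k) J)).
apply: eq_bigr => i _; rewrite exchange_big /=; apply: eq_bigr => k _.
rewrite -[RHS](sum_eq (fun j => (P a c * (a == i)%:R * (c == k)%:R + L a c * (a ==
  k)%:R * (c == i)%:R) * X (idx3 i j k) J) b).
by apply: eq_bigr => j _; rewrite leg13E RE; ring.
Qed.

Lemma leg23_mulE (X : 'M[F]_(m * m * m)) a b c J :
  (leg23 R *m X) (idx3 a b c) J = P b c * X (idx3 a b c) J + L b c * X (idx3 a c b) J.
Proof.
rewrite mxE sum_idx3 -[RHS](sum_eq (fun i => P b c * X (idx3 i b c)
  J + L b c * X (idx3 i c b) J) a).
apply: eq_bigr => i _; rewrite -(sum_two (P b c) (L b c)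
  b c b c (fun j k => X (idx3 i j k) J)).
rewrite mulr_suml; apply: eq_bigr => j _; rewrite mulr_suml; apply: eq_bigr => k _.
by rewrite leg23E RE; ring.
Qed.

End YangBaxter.

(** Expanded on the row (a, b, c), both sides combine rows indexed by permutations of a, b, c, with
    coefficients that depend only on the order of [beta a], [beta b], [beta c]. Each order, ties
    included, leaves a rational identity in p. *)
Lemma hecke_yang_baxter (RR : realType) (F : fieldType) (m : nat) (R : 'M[F]_(m * m))
    (beta : 'I_m -> RR) (p : F) : injective beta -> p != 0 ->
  (forall a b c d, tens_coef R a b c d =
     (if a == c then p else 1) * (a == b)%:R * (c == d)%:R
     + (if beta c < beta a then p - p^-1 else 0) * (a == d)%:R * (c == b)%:R) ->
  leg12 R *m leg13 R *m leg23 R = leg23 R *m leg13 R *m leg12 R.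
Proof.
move=> inj_beta p0 RE.
(* Equality of indices is restated through [beta], so that comparing the values of [beta] decides
   every conditional. *)
pose P (a c : 'I_m) : F := if beta a == beta c then p else 1.
pose L (a c : 'I_m) : F := if beta c < beta a then p - p^-1 else 0.
have {}RE a b c d : tens_coef R a b c d =
    P a c * (a == b)%:R * (c == d)%:R + L a c * (a == d)%:R * (c == b)%:R.
  by rewrite RE /P (inj_eq inj_beta).
(* A trailing identity, generalized to X below, brings the last leg to the form of the row rules. *)
rewrite -!mulmxA -[in LHS](mulmx1 (leg23 R)) -[in RHS](mulmx1 (leg12 R)).
apply/matrixP => I J; have [a [b [c ->]]] : exists a b c, I = idx3 a b c.
  case: (mxtens_indexP I) => i k; case: (mxtens_indexP i) => a b.
  by exists a, b, k.
rewrite !(leg12_mulE RE, leg13_mulE RE, leg23_mulE RE).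
move: (1%:M : 'M[F]_(m * m * m)) => X; rewrite /P /L.
case: (ltgtP (beta a) (beta b)) => [ab|ab|/inj_beta ab];
case: (ltgtP (beta a) (beta c)) => [ac|ac|/inj_beta ac];
case: (ltgtP (beta b) (beta c)) => [bc|bc|/inj_beta bc];
  subst; repeat match goal with H : ?x = ?x |- _ => clear H end;
  try (exfalso; lra); rewrite ?ltxx ?eqxx; by field.
Qed.

(** * Tensor indices *)

Section TensorIndex.
Variables (F : comNzRingType) (m : nat).
Implicit Types i j : 'I_(m * m).

Definition fst_idx i : 'I_m := (mxtens_unindex i).1.
Definition snd_idx i : 'I_m := (mxtens_unindex i).2.
Definition flip i : 'I_(m * m) := mxtens_index (snd_idx i, fst_idx i).

Lemma idxE i : i = mxtens_index (fst_idx i, snd_idx i).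
Proof. by rewrite -surjective_pairing mxtens_unindexK. Qed.
Lemma fst_idxE a b : fst_idx (mxtens_index (a, b)) = a.
Proof. by rewrite /fst_idx mxtens_indexK. Qed.
Lemma snd_idxE a b : snd_idx (mxtens_index (a, b)) = b.
Proof. by rewrite /snd_idx mxtens_indexK. Qed.
Lemma flipE a b : flip (mxtens_index (a, b)) = mxtens_index (b, a).
Proof. by rewrite /flip fst_idxE snd_idxE. Qed.
Lemma flipK : involutive flip.
Proof. by move=> i; rewrite [i in RHS]idxE /flip fst_idxE snd_idxE. Qed.
Lemma eq_idx a b c d :
  (mxtens_index (a, b) == mxtens_index (c, d) :> 'I_(m * m)) = (a == c) && (b == d).
Proof. by rewrite (can_eq (@mxtens_indexK m m)). Qed.
Lemma omega_idx a b : omega flip (mxtens_index (a, b)) = (a == b).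
Proof. by rewrite /omega flipE eq_idx eq_sym andbb. Qed.

Lemma diagOmegaE : diagOmega F m = diag_mx (\row_j (omega flip j)%:R).
Proof.
apply/matrixP => i j; rewrite (idxE i) (idxE j).
move: (fst_idx i) (snd_idx i) (fst_idx j) (snd_idx j) => a b c d.
rewrite summxE !mxE omega_idx eq_idx.
under eq_bigr => e _ do rewrite tensmxE !mxE -natrM mulnb.
have [/andP[/eqP <- /eqP <-]|h] := boolP ((a == c) && (b == d)).
  rewrite mulr1n (bigD1 a) //= eqxx big1 ?addr0 /= => [|e /negPf ea].
    by rewrite eq_sym andbb.
  by rewrite [a == e]eq_sym ea.
rewrite mulr0n big1 // => e _; case: (a =P e) h => [<-|] //=.
case: (c =P a) => [->|] //=; case: (b =P a) => [->|] //=; case: (d =P a) => [->|] //=.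
by rewrite !eqxx.
Qed.

Lemma OmegaE i j : Omega F m i j = (j == flip i)%:R.
Proof.
rewrite (idxE i) (idxE j).
move: (fst_idx i) (snd_idx i) (fst_idx j) (snd_idx j) => a b c d.
rewrite flipE eq_idx /Omega summxE (bigD1 a) //= [X in _ + X]big1 => [|e /negPf ea];
  last first.
  rewrite summxE big1 // => f _.
  by rewrite tensmxE !mxE [a == e]eq_sym ea mul0r.
rewrite addr0 summxE (bigD1 c) //= [X in _ + X]big1 => [|f /negPf fc]; last first.
  by rewrite tensmxE !mxE [c == f]eq_sym fc andbF mul0r.
by rewrite addr0 tensmxE !mxE !eqxx mul1r [b == c]eq_sym.
Qed.

Lemma Omega_mulE (A : 'M[F]_(m * m)) i j : (Omega F m *m A) i j = A (flip i) j.
Proof.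
rewrite mxE (bigD1 (flip i)) //= OmegaE eqxx mul1r big1 ?addr0 // => k /negPf ki.
by rewrite OmegaE ki mul0r.
Qed.

End TensorIndex.

(** * Translation of the stated system into the abstract one *)

Section Link.
Variable RR : realType.
Local Notation C := RR[i].
Variables (m : nat) (kappa : C) (u : 'rV[C]_m).
Hypothesis kappa_neq0 : kappa != 0.
Hypothesis u_distinct : forall a b : 'I_m, a != b -> u 0 a != u 0 b.
Hypothesis u_imaginary : forall a : 'I_m, complex.Re (kappa^-1 * u 0 a) = 0.
Local Notation M := 'M[C]_(m * m).
Local Notation c := (kappa^-1).

Let beta (a : 'I_m) : RR := complex.Im (c * u 0 a).
Let alpha (i : 'I_(m * m)) : RR := beta (fst_idx i).
Let fl := @flip m.
Let U (i : 'I_(m * m)) : C := 0 +i* alpha i.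

Lemma u_beta a : c * u 0 a = 0 +i* beta a.
Proof. exact: complex_ext. Qed.

Lemma beta_inj : injective beta.
Proof.
move=> a b ab; apply: contraTeq isT => /u_distinct.
have : c * u 0 a = c * u 0 b by rewrite !u_beta ab.
by move/(mulfI (invr_neq0 kappa_neq0)) => ->; rewrite eqxx.
Qed.

Lemma u1E : u1 u = diag_mx (\row_i u 0 (fst_idx i)).
Proof.
apply/matrixP => i j; rewrite (idxE i) (idxE j).
move: (fst_idx i) (snd_idx i) (fst_idx j) (snd_idx j) => a b d e.
rewrite tensmxE !mxE eq_idx fst_idxE.
by case: (a =P d) => [->|_] /=; case: (b =P e) => _ /=;
  rewrite ?mulr1 ?mulr0 ?mul0r ?mulr1n ?mulr0n ?mulr1 ?mulr0 ?mul0r.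
Qed.

Lemma UE i : U i = c * u 0 (fst_idx i).
Proof. by rewrite u_beta. Qed.

Lemma expdiag_diag n (x : C) (d : 'rV[C]_n) :
  expdiag (x *: diag_mx d) = diag_mx (\row_j cexp (x * d 0 j)).
Proof. by apply/matrixP => i j; rewrite !mxE eqxx mulr1n. Qed.

Lemma with_exponentsE b H : with_exponents kappa u b H = with_expo fl alpha c b H.
Proof.
apply/funext => z; apply/matrixP => i j.
rewrite /with_exponents u1E diagOmegaE !expdiag_diag !mul_mx_diag !mxE.
rewrite -mulrA -cexpD /expo; congr (_ * cexp _).
by rewrite -/(U j) UE; ring.
Qed.

Lemma alpha_flip i : fl i != i -> alpha i != alpha (fl i).
Proof.
rewrite (idxE i) /fl flipE /alpha !fst_idxE eq_idx.
move: (fst_idx i) (snd_idx i) => a b h; rewrite (inj_eq beta_inj).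
by apply: contraNneq h => ->; rewrite eqxx.
Qed.

Lemma alpha_fixed i j : fl i = i -> fl j = j -> alpha i = alpha j -> i = j.
Proof.
rewrite (idxE i) (idxE j) /fl !flipE /alpha !fst_idxE.
move: (fst_idx i) (snd_idx i) (fst_idx j) (snd_idx j) => a b d e.
by move=> /eqP; rewrite eq_idx => /andP[/eqP-> _] /eqP;
  rewrite eq_idx => /andP[/eqP-> _] /beta_inj ->.
Qed.

Lemma formal_entries Hf : formal_solution kappa u Hf -> forall l i j,
  - (l%:R * Hf l i j) + Hf l.+1 i j * (U j - U i) + c * (omega fl j)%:R * Hf l i j
  = c * Hf l (fl i) j.
Proof.
move=> [_ H] l i j; have := congr1 (fun A : M => A i j) (H l).
rewrite u1E diagOmegaE mul_diag_mx !mul_mx_diag [X in _ = X -> _]mxE Omega_mulE !mxE.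
rewrite -/fl -[omega _ j]/(omega fl j) !UE => E.
rewrite (_ : Hf l (fl i) j = - (kappa *+ l * Hf l i j) + Hf l.+1 i j * u 0 (fst_idx j)
  + Hf l i j * (omega fl j)%:R - u 0 (fst_idx i) * Hf l.+1 i j).
  by rewrite -mulr_natr; field.
by rewrite E; ring.
Qed.

Lemma half_plane_hp b : half_plane b = hp ((-1) ^+ b) :> set C.
Proof. by []. Qed.

Lemma solution_msol D Y : is_solution kappa u D Y -> msol fl U c D Y.
Proof.
move=> H z Dz i j; have [dY hY E] := H z Dz.
apply: cderiv_at_eq (cderiv_at_holo (hY i j)) _.
have := congr1 (fun A : M => c * A i j) E; rewrite mxE mulKf // => ->.
by rewrite mulmxDl -scalemxAl mxE [X in _ + X]mxE Omega_mulE u1E mul_diag_mx !mxE UE;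
  ring.
Qed.

Lemma asymptotic_ray b (H : C -> M) (Hf : nat -> M)
  : asymptotic_to b H Hf -> ray_asymptotic Hf H.
Proof.
move=> aH w w0 k i j; have [theta th sec] := @sector_ray RR b w (or_intror w0).
have [K [r Hr]] := aH theta k th.
have wn0 : 0 < cabs w.
  by rewrite cabs_gt0; apply: contraNneq w0 => ->.
exists (K * cabs w ^- k); exists (maxn 1 (Num.bound `|r / cabs w|)) => n.
rewrite geq_max => /andP[n1 nr]; have n0 : 0 < n%:R :> RR by rewrite ltr0n.
have nE : (n%:R : C) = (n%:R)%:C by rewrite rmorph_nat.
have zs : sector b theta (ray w n) by rewrite /ray nE; exact: sec.
have cz : cabs (ray w n) = n%:R * cabs w by rewrite /ray cabsM cabs_nat.
have zr : r <= cabs (ray w n).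
  rewrite cz -ler_pdivrMr //; apply/ltW/(lt_le_trans (ltr_archi _)).
  by rewrite ler_nat.
have := Hr _ zs zr i j; rewrite !mxE summxE.
under eq_bigr => l _ do rewrite mxE.
rewrite cz exprMn => h; rewrite -ler_pdivlMr ?exprn_gt0 //; apply: le_trans h _.
by rewrite invfM [_^-1 * _]mulrC mulrA.
Qed.

Lemma supersector_derivable b (H : C -> M) z i j : holomorphic_on (supersector b) H ->
  complex.Im z != 0 -> exists d, cderiv_at (fun z => H z i j) z d.
Proof.
move=> hH z0; have := hH z (supersectorP (or_intror z0)) i j => hd.
by eexists; apply: cderiv_at_holo; exact: derivableP.
Qed.

Lemma blog_falseE (z : C) : blog false z = clog z.
Proof.
rewrite /blog mul1r.
by apply: complex_ext; rewrite ?(cReD, cImD) ?(cReN, cImN); exact: subr0.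
Qed.

Lemma expo_derivable z j : 0 < complex.Im z ->
  exists d, cderiv_at (fun z => expo fl alpha c false z j) z d.
Proof.
move=> z0; set w := c * (omega fl j)%:R.
have h1 := cderiv_atM (@cderiv_at_id RR z) (@cderiv_at_cst RR (U j) z).
have h2 := cderiv_atM (cderiv_at_clog z0) (@cderiv_at_cst RR w z).
eexists; apply: cderiv_at_ext (cderiv_at_cexp (cderiv_atD h1 h2)) => x.
by rewrite /expo blog_falseE.
Qed.

(** The continuation of Y_+ agrees with Y_+ in the second quadrant, which gives the Stokes relation
    there; it remains to extend the equation for Y_+ to the upper half plane. *)
Lemma stokes_matrix_entries Sp Sm : stokes_matrices kappa u Sp Sm ->
  forall i j, Sp i j = stokes_entry fl alpha c i j.
Proof.
move=> [Hf [Hp [Hm [fH [hp_hol hp_sol hp_as] [_ hm_sol hm_as] [Yc [_ YcE] SpE] _]]]].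
have Hf0 : Hf 0%N = 1%:M by case: fH.
have asp := asymptotic_ray hp_as; have asm := asymptotic_ray hm_as.
rewrite !with_exponentsE in hp_sol hm_sol YcE SpE.
set Yp := with_expo fl alpha c false Hp in hp_sol YcE.
set Ym := with_expo fl alpha c true Hm in hm_sol SpE.
have sp : msol fl U c (hp 1) Yp by exact: solution_msol.
have sm : msol fl U c (hp (-1)) Ym.
  by have := solution_msol hm_sol; rewrite half_plane_hp expr1.
have YE z : complex.Re z < 0 -> 0 < complex.Im z -> Ym z = Yp z *m Sp.
  move=> zr zi; have hz : half_plane true z by rewrite half_plane_hp expr1 hpN1.
  by rewrite SpE // YcE // expr0 mul1r.
(* Y_- is invertible far out on the ray through -1 + i, and it factors through [Sp] there. *)
have uS : Sp \in unitmx.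
  pose w : C := dir (-1) 1.
  have w0 : complex.Im w != 0 by rewrite /= oner_eq0.
  have [n [n0 /(_ n true (leqnn _))[_ um]]] := unit_far fl alpha c (H := Hm)
    (tends_H Hf0 asm w0).
  have h1 : hp (-1) w by rewrite hpN1 /= oppr_lt0.
  have h2 : hp (- 'i) w by rewrite hp_imag.
  have := hp_ray h1 n0; have := hp_ray h2 n0; rewrite hpN1 hp_imag => zi zr.
  by move: um; rewrite -/(Ym _) YE // unitmx_mul => /andP[].
(* In the second quadrant Y_+ is Y_- times a constant; on the imaginary axis it is differentiable
   because H_+ is holomorphic on the supersector. *)
have spu : msol fl U c (hp (- 'i)) Yp.
  apply: msol_upper => //.
    move=> z zr zi i j; have hz : hp (-1) z by rewrite hpN1.
    have E x : complex.Re x < 0 /\ 0 < complex.Im x -> (Ym x *m invmx Sp) i j = Yp x i j.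
      by move=> [xr xi]; rewrite YE // mulmxK.
    have zE : Yp z = Ym z *m invmx Sp by rewrite YE // mulmxK.
    rewrite zE; apply: cderiv_at_local E (msol_mulmx (invmx Sp) sm hz i j).
    by move=> g t e gt; apply: near_quadrant; rewrite gt.
  move=> z zi i j; have [d1 h1] := supersector_derivable i j hp_hol (lt0r_neq0 zi).
  have [d2 h2] := expo_derivable j zi.
  by eexists; apply: cderiv_at_ext (cderiv_atM h1 h2) => x; rewrite mxE.
exact: (stokes_matrixE (@flipK m) alpha_flip alpha_fixed Hf0 (formal_entries fH)
  asp asm sp spu sm YE).
Qed.

Local Notation p := (cexp (- ((0 +i* pi) * c)) : C).

(** On e_a (x) e_a the half turn of the prefactor meets minus a full turn from S_+, leaving p. On
    the other rows the prefactor is 1 and the off-diagonal entry e^(-q) - e^q is p - p^-1. *)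
Lemma stokes_multiplier_entries R : stokes_multiplier kappa u R ->
  forall a b d e, tens_coef R a b d e =
     (if a == d then p else 1) * (a == b)%:R * (d == e)%:R
     + (if beta d < beta a then p - p^-1 else 0) * (a == e)%:R * (d == b)%:R.
Proof.
move=> [Sp [Sm [hS ->]]] a b d e;
  rewrite /tens_coef diagOmegaE expdiag_diag mul_diag_mx !mxE.
rewrite (stokes_matrix_entries hS) /stokes_entry /alpha /fl flipE !fst_idxE !eq_idx.
rewrite -[omega _ _]/(omega fl _) omega_idx.
have [/andP[/eqP <- /eqP <-]|ne] := boolP ((a == b) && (d == e)).
  rewrite !eqxx !mulr1; have [<-|ad] := eqVneq a d.
    rewrite ltxx /= !mul0r addr0 !mulr1 -cexpD; congr cexp.
    by apply: complex_ext; rewrite !ReImE /= mulr2n; ring.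
  by rewrite !(mulr0n, mulr0) oppr0 cexp0 addr0 mul1r.
have -> : (if a == d then p else 1) * (a == b)%:R * (d == e)%:R = 0 :> C.
  by rewrite -mulrA -natrM mulnb (negPf ne) mulr0.
rewrite add0r; have [/andP[/eqP eb /eqP ee]|ne'] := boolP ((b == d) && (e == a)).
  subst b e; move: ne; rewrite [d == a]eq_sym andbb => /negPf ad.
  by rewrite ad !eqxx mulr0 cexp0 mul1r !mulr1 /= [in RHS]cexpN invrK -cexpN.
by rewrite /= mulr0 -mulrA -natrM mulnb andbC [d == b]eq_sym [a == e]eq_sym (negPf ne')
  mulr0.
Qed.

Lemma stokes_multiplier_yang_baxter R : stokes_multiplier kappa u R ->
  leg12 R *m leg13 R *m leg23 R = leg23 R *m leg13 R *m leg12 R.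
Proof.
move=> /stokes_multiplier_entries; apply: hecke_yang_baxter; first exact: beta_inj.
exact: cexp_neq0.
Qed.

End Link.

Theorem theorem1p2 (RR : realType) (m : nat) (kappa : RR[i]) (u : 'rV[RR[i]]_m)
    (kappa_neq0 : kappa != 0)
    (u_distinct : forall a b : 'I_m, a != b -> u 0 a != u 0 b)
    (u_imaginary : forall a : 'I_m, complex.Re (kappa^-1 * u 0 a) = 0)
    (R : 'M[RR[i]]_(m * m)) (R_stokes : stokes_multiplier kappa u R) :
  leg12 R *m leg13 R *m leg23 R = leg23 R *m leg13 R *m leg12 R.
Proof. exact: stokes_multiplier_yang_baxter R_stokes. Qed.
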